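(* For generic $\mathcal{X}=\{x_1,\dots,x_n\}$ and $\mathcal{Y}=\{y_1,\dots,y_n\}$ in $\mathbb{P}^2$, the locus of centers $(a,b)\in\mathbb{P}^2\times\mathbb{P}^2$ of pairs of flatland cameras $(A,B)$ ($A$ with center $a$, $B$ with center $b$) such that $Ax_i\sim By_i$ for all $i=1,\dots,n$ satisfies the following: (i) If $n<4$, both $a$ and $b$ may be chosen arbitrarily in $\mathbb{P}^2$. (ii) If $n=4$, then one of the centers may be chosen arbitrarily, and this choice determines a plane conic on which the other center can be chosen arbitrarily. (iii) If $n=5$, then one of the centers may be chosen arbitrarily, and this choice determines the other center uniquely. (iv) If $n=6$, $a$ and $b$ must lie on plane cubic curves $C_x$ and $C_y$, respectively; if $a\in C_x$ is chosen arbitrarily, then $b\in C_y$ is uniquely determined, and vice versa. (v) If $n=7$, there are at most three choices for the pair $(a,b)$. (vi) If $n>7$, the locus of $(a,b)$ is empty.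
   Context: $\mathbb{P}^k$ is $k$-dimensional real projective space; points are represented by nonzero vectors in $\mathbb{R}^{k+1}$, and $u\sim v$ means $u=\lambda v$ for some nonzero scalar $\lambda$. $\mathcal{X}$ and $\mathcal{Y}$ are two sets of $n$ labeled points in $\mathbb{P}^2$, assumed sufficiently generic. A flatland camera is a rank $2$ (full rank) linear projection $\mathbb{P}^2\dashrightarrow\mathbb{P}^1$, represented by a $2\times 3$ matrix of rank $2$; its center is the unique point of $\mathbb{P}^2$ in the right nullspace of the matrix, where the projection is undefined.
   Formalization: ''Chosen arbitrarily'' is proved for a generic choice: a center in P^2 outside some plane curve, or a point of the conic or cubic outside a finite set; choosing literally any point fails (e.g. a = x_i, or for n = 3 a on the line x_1x_2). *)

(* Defs.v *)
From HB Require Import structures.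
From mathcomp Require Import all_boot all_order all_algebra.
From mathcomp Require Import reals.
From mathcomp Require Import mpoly.

Set Implicit Arguments.
Unset Strict Implicit.
Unset Printing Implicit Defensive.

Import GRing.Theory.
Local Open Scope ring_scope.

(* A point of the real projective space P^k is represented by a nonzero column
   vector in R^(k+1); two representatives denote the same point when they are
   related by [proj_eq].  A tuple of n labeled points of P^2 is a 3 x n matrix
   whose i-th column represents the i-th point. *)

Definition proj_eq (R : realType) (m : nat) (u v : 'cV[R]_m) : Prop :=
  exists2 lambda : R, lambda != 0 & u = lambda *: v.

Definition point_tuple (R : realType) (n : nat) (X : 'M[R]_(3, n)) : Prop :=
  forall i : 'I_n, col i X != 0.

Definition flatland_camera (R : realType) (A : 'M[R]_(2, 3)) : Prop :=
  \rank A = 2%N.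

Definition is_center (R : realType) (A : 'M[R]_(2, 3)) (a : 'cV[R]_3) : Prop :=
  a != 0 /\ A *m a = 0.

(* A camera is undefined at its center, so for A x_i and B y_i to be the same
   point of P^1 both image vectors have to be nonzero. *)
Definition same_images (R : realType) (n : nat) (X Y : 'M[R]_(3, n))
    (A B : 'M[R]_(2, 3)) : Prop :=
  forall i : 'I_n,
    [/\ A *m col i X != 0, B *m col i Y != 0
      & proj_eq (A *m col i X) (B *m col i Y)].

Definition center_locus (R : realType) (n : nat) (X Y : 'M[R]_(3, n))
    (a b : 'cV[R]_3) : Prop :=
  exists A B : 'M[R]_(2, 3),
    [/\ flatland_camera A, flatland_camera B, is_center A a, is_center B b
      & same_images X Y A B].

(* Generic (X, Y): outside the zero set of some nonzero polynomial in the 6n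
   coordinates of the representatives.  For a property of the projective points
   (i.e. invariant under rescaling each column) this is the same as holding on
   a nonempty Zariski open subset of (P^2)^n x (P^2)^n. *)
Definition for_generic_tuples (R : realType) (n : nat)
    (P : 'M[R]_(3, n) -> 'M[R]_(3, n) -> Prop) : Prop :=
  exists2 p : {mpoly R[(3 + 3) * n]}, p != 0 &
    forall X Y : 'M[R]_(3, n), point_tuple X -> point_tuple Y ->
      p.@[fun k => mxvec (col_mx X Y) 0 k] != 0 -> P X Y.

Definition plane_form (R : realType) (d : nat) (f : {mpoly R[3]}) : Prop :=
  f != 0 /\ f \is d.-homog.

Definition on_curve (R : realType) (f : {mpoly R[3]}) (a : 'cV[R]_3) : Prop :=
  a != 0 /\ f.@[fun k => a k 0] = 0.

(* An arbitrary choice of a point of P^2 is a choice in a nonempty Zariski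
   open subset: special positions (such as a center lying on the line through
   two of the given points) are excluded. *)
Definition for_generic_point (R : realType) (P : 'cV[R]_3 -> Prop) : Prop :=
  exists (d : nat) (f : {mpoly R[3]}), plane_form d f /\
    forall a : 'cV[R]_3, a != 0 -> ~ on_curve f a -> P a.

Definition avoids (R : realType) (s : seq 'cV[R]_3) (a : 'cV[R]_3) : Prop :=
  forall c : 'cV[R]_3, c \in s -> ~ proj_eq a c.

(* An arbitrary choice of a point on a plane curve allows finitely many
   exceptions; the first clause, that the curve has infinitely many real
   points, keeps the second one from being vacuous. *)
Definition for_generic_point_on (R : realType) (f : {mpoly R[3]})
    (P : 'cV[R]_3 -> Prop) : Prop :=
  (forall s : seq 'cV[R]_3, exists2 a, on_curve f a & avoids s a) /\
  (exists s : seq 'cV[R]_3, forall a, on_curve f a -> avoids s a -> P a).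

Definition unique_point (R : realType) (P : 'cV[R]_3 -> Prop) : Prop :=
  exists2 b : 'cV[R]_3, P b & forall b', P b' -> proj_eq b' b.

(* The set of points P is a plane conic, up to finitely many points of it. *)
Definition fills_conic (R : realType) (P : 'cV[R]_3 -> Prop) : Prop :=
  exists q : {mpoly R[3]},
    [/\ plane_form 2 q, forall b, P b -> on_curve q b
      & for_generic_point_on q P].

(* Main.v *)
Require Import Defs.
From mathcomp Require Import all_boot all_order all_algebra.
From mathcomp Require Import reals.
From mathcomp Require Import mpoly.
From mathcomp Require Import ring lra polyrcf.
From mathcomp Require boolp.

(** A pair of cameras [A], [B] is encoded by the matrix [F = A^T J B], where [J]
    is the determinant pairing on the plane: [A x] and [B y] represent the same
    point exactly when [x^T F y = 0], and the centers [a], [b] span the left and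
    the right kernel of [F].  As every matrix of rank 2 factors in this way, the
    locus consists of the pairs of kernels of the rank 2 solutions of the [n]
    linear equations [x_i^T F y_i = 0], pairs with [a = x_i] or [b = y_i] being
    excluded ([center_locusP]).  The statements are then a dimension count in
    the nine-dimensional space of matrices.

    For few points, move the first three points of each tuple to the coordinate
    points.  Then [F] has zero diagonal, and if [a] is its left kernel then
    [F v = a × (g ∘ v)] for some vector [g], where [∘] is the entrywise product
    ([zero_diag_epi_mx]).  The right kernel satisfies [g ∘ b ~ a], that is,
    [b = a / g] entrywise, and each further pair imposes the linear equation
    [g · w_j = 0] with [w_j = y_j ∘ (a × x_j)].  So three pairs impose nothing;
    four leave a line of vectors [g], whose image under [g |-> a / g] is a conic;
    five determine [g = w_4 × w_5] and hence [b].  With six pairs a solution [g]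
    exists exactly when the cubic form [det (w_4, w_5, w_6)] vanishes at [a].  If
    there were two independent solutions [g], [h], the [w_j] would all be parallel
    to [m = g × h]; from [x_j · (a × x_j) = 0] one gets [(x_j / y_j) · m = 0] for
    the three [j], which is excluded for generic points.  Thus, away from the
    points [x_i], a point of the cubic is the left kernel of only one [F] up to
    scale ([six_points_cubic]).  It has rank 2 because a form [u v^T] would
    put three of the [x_i] or three of the [y_i] on a line, and its right kernel
    is one of the [y_i] for finitely many [a] only ([six_points]).  The cubic has
    infinitely many real points because every real line meets it
    ([odd_curve_infinite]).

    Eight generic pairs leave a single form [B] up to scale, and [det B] is not
    zero ([eight_points]).  For seven pairs, add an auxiliary eighth pair: the
    solutions with value 1 at that pair form a line [F_1 + c B], on which the
    determinant is a cubic polynomial in [c] with leading coefficient [det B],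
    hence has at most three roots ([seven_points]).

    Genericity is everywhere the non-vanishing of a polynomial in the coordinates
    of the points, and it is established by exhibiting one configuration where
    that polynomial does not vanish ([generic_polyfun]). *)

Set Implicit Arguments.
Unset Strict Implicit.
Unset Printing Implicit Defensive.

Import Order.TTheory GRing.Theory Num.Theory.
Local Open Scope ring_scope.

(** * Vectors and matrices of size three *)

Local Notation o0 := (@Ordinal 3 0 isT).
Local Notation o1 := (@Ordinal 3 1 isT).
Local Notation o2 := (@Ordinal 3 2 isT).

Lemma ord3_ind (P : 'I_3 -> Prop) : P o0 -> P o1 -> P o2 -> forall i, P i.
Proof.
move=> P0 P1 P2 [[|[|[|i]]] Hi] //.
- by rewrite (_ : Ordinal Hi = o0) //; apply: val_inj.
- by rewrite (_ : Ordinal Hi = o1) //; apply: val_inj.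
- by rewrite (_ : Ordinal Hi = o2) //; apply: val_inj.
Qed.

Lemma sum3 (V : nmodType) (E : 'I_3 -> V) : \sum_i E i = E o0 + E o1 + E o2.
Proof.
rewrite !big_ord_recr big_ord0 /= add0r.
by congr (E _ + E _ + E _); apply: val_inj.
Qed.

Lemma det3 (S : comNzRingType) (M : 'M[S]_3) :
  \det M = M o0 o0 * (M o1 o1 * M o2 o2 - M o1 o2 * M o2 o1)
         - M o0 o1 * (M o1 o0 * M o2 o2 - M o1 o2 * M o2 o0)
         + M o0 o2 * (M o1 o0 * M o2 o1 - M o1 o1 * M o2 o0).
Proof.
have det2 (N : 'M[S]_2) : \det N = N ord0 ord0 * N ord_max ord_max
                                - N ord0 ord_max * N ord_max ord0.
  rewrite (expand_det_row N ord0) !big_ord_recr big_ord0 /= add0r.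
  rewrite /cofactor !det_mx11 !mxE /= expr0 expr1 mul1r mulN1r mulrN.
  by congr (N _ _ * N _ _ - N _ _ * N _ _); apply: val_inj.
rewrite (expand_det_row M o0) sum3 /cofactor !det2 !mxE.
have E (i k : 'I_3) (j : 'I_2) : bump i j = k :> nat -> lift i j = k.
  by move=> h; apply: val_inj.
rewrite (E o0 o1 ord0) // (E o0 o2 ord_max) // (E o1 o0 ord0) //.
rewrite (E o1 o2 ord_max) // (E o2 o0 ord0) // (E o2 o1 ord_max) //=.
ring.
Qed.

Section Space.
Variable R : realType.
Implicit Types (u v w a b g x y : 'cV[R]_3) (F G : 'M[R]_3).

Lemma col3P u v : u o0 0 = v o0 0 -> u o1 0 = v o1 0 -> u o2 0 = v o2 0 -> u = v.
Proof. by move=> h0 h1 h2; apply/matrixP => i j; rewrite ord1; elim/ord3_ind: i. Qed.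

Definition vec3 (r s t : R) : 'cV[R]_3 := \col_i [:: r; s; t]`_i.

Definition cross u v : 'cV[R]_3 :=
  vec3 (u o1 0 * v o2 0 - u o2 0 * v o1 0)
       (u o2 0 * v o0 0 - u o0 0 * v o2 0)
       (u o0 0 * v o1 0 - u o1 0 * v o0 0).

Definition hadamard u v : 'cV[R]_3 := \col_i (u i 0 * v i 0).

Definition dot u v : R := \sum_i u i 0 * v i 0.

Definition cross_mx a : 'M[R]_3 := \matrix_(i, j) cross a (delta_mx j 0) i 0.

Lemma col3_neq0 v : v != 0 -> [\/ v o0 0 != 0, v o1 0 != 0 | v o2 0 != 0].
Proof.
move=> v0; case: (eqVneq (v o0 0) 0) => [h0|]; last by constructor 1.
case: (eqVneq (v o1 0) 0) => [h1|]; last by constructor 2.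
case: (eqVneq (v o2 0) 0) => [h2|]; last by constructor 3.
by case/eqP: v0; apply: col3P; rewrite ?h0 ?h1 ?h2 mxE.
Qed.

Lemma col_neq0 n (v : 'cV[R]_n) i : v i 0 != 0 -> v != 0.
Proof. by apply: contra_neq => ->; rewrite mxE. Qed.

Lemma mul_cross_mx a v : cross_mx a *m v = cross a v.
Proof.
by apply: col3P; rewrite !mxE sum3 ?mxE /= ?mxE /=; ring.
Qed.

Lemma cross_eq0 u v : cross u v = 0 -> v != 0 -> exists c, u = c *: v.
Proof.
move=> /matrixP uv0 /col3_neq0.
have := uv0 o0 0; have := uv0 o1 0; have := uv0 o2 0; rewrite !mxE /=.
move=> h2 h1 h0; case=> nz.
- exists (u o0 0 / v o0 0); apply: col3P; rewrite !mxE.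
  + by rewrite divfK.
  + by apply: (mulfI nz); rewrite mulrA [v o0 0 * (_ / _)]mulrC divfK //; lra.
  + by apply: (mulfI nz); rewrite mulrA [v o0 0 * (_ / _)]mulrC divfK //; lra.
- exists (u o1 0 / v o1 0); apply: col3P; rewrite !mxE.
  + by apply: (mulfI nz); rewrite mulrA [v o1 0 * (_ / _)]mulrC divfK //; lra.
  + by rewrite divfK.
  + by apply: (mulfI nz); rewrite mulrA [v o1 0 * (_ / _)]mulrC divfK //; lra.
- exists (u o2 0 / v o2 0); apply: col3P; rewrite !mxE.
  + by apply: (mulfI nz); rewrite mulrA [v o2 0 * (_ / _)]mulrC divfK //; lra.
  + by apply: (mulfI nz); rewrite mulrA [v o2 0 * (_ / _)]mulrC divfK //; lra.
  + by rewrite divfK.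
Qed.

Lemma dotE u v : dot u v = u o0 0 * v o0 0 + u o1 0 * v o1 0 + u o2 0 * v o2 0.
Proof. exact: sum3. Qed.

Lemma dotC u v : dot u v = dot v u.
Proof. by rewrite !dotE; ring. Qed.

Lemma dot_cross1 u v : dot u (cross u v) = 0.
Proof. by rewrite dotE !mxE /=; ring. Qed.

Lemma dot_cross2 u v : dot v (cross u v) = 0.
Proof. by rewrite dotE !mxE /=; ring. Qed.

Lemma perp_cross u v h : cross u v != 0 -> dot h u = 0 -> dot h v = 0 ->
  exists c, h = c *: cross u v.
Proof.
rewrite !dotE => nz hu hv; apply: cross_eq0 => //.
(* Lagrange: h × (u × v) = (h · v) u - (h · u) v. *)
apply: col3P; rewrite !mxE /= ?mxE /=.
- transitivity (u o0 0 * 0 - v o0 0 * 0); last by ring.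
  by rewrite -{1}hv -hu; ring.
- transitivity (u o1 0 * 0 - v o1 0 * 0); last by ring.
  by rewrite -{1}hv -hu; ring.
- transitivity (u o2 0 * 0 - v o2 0 * 0); last by ring.
  by rewrite -{1}hv -hu; ring.
Qed.

Lemma proj_eq_sym (m : nat) (u v : 'cV[R]_m) : proj_eq u v -> proj_eq v u.
Proof.
by case=> c c0 ->; exists c^-1; rewrite ?invr_eq0 // scalerA mulVf ?scale1r.
Qed.

Lemma proj_eq_trans (m : nat) (u v w : 'cV[R]_m) :
  proj_eq u v -> proj_eq v w -> proj_eq u w.
Proof.
by case=> c c0 -> [d d0 ->]; exists (c * d); rewrite ?mulf_neq0 // scalerA.
Qed.

Lemma proj_eq_scale (m : nat) (u v : 'cV[R]_m) c : u != 0 -> u = c *: v -> proj_eq u v.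
Proof.
move=> u0 uE; exists c => //; apply: contra_neq u0 => c0.
by rewrite uE c0 scale0r.
Qed.

Lemma proj_eqM (m n : nat) (N : 'M[R]_(n, m)) (u v : 'cV[R]_m) :
  proj_eq u v -> proj_eq (N *m u) (N *m v).
Proof. by case=> c c0 ->; exists c; rewrite // -scalemxAr. Qed.

Lemma rank2_ker m (M : 'M[R]_(m, 3)) u v : \rank M = 2%N ->
  M *m u = 0 -> M *m v = 0 -> v != 0 -> exists c, u = c *: v.
Proof.
move=> rM Mu Mv v0.
have sub w : M *m w = 0 -> (w^T <= kermx M^T)%MS.
  by move=> Mw; apply/sub_kermxP; rewrite -trmx_mul Mw trmx0.
have rk : \rank (kermx M^T) = 1%N by rewrite mxrank_ker mxrank_tr rM.
have rv : \rank v^T = 1%N by rewrite rank_rV -trmx0 (inj_eq trmx_inj) v0.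
have kv : (kermx M^T <= v^T)%MS.
  by rewrite -(mxrank_leqif_sup (sub _ Mv)) rk rv.
have /sub_rVP[c cE] := submx_trans (sub _ Mu) kv.
by exists c; rewrite -[u]trmxK cE linearZ /= trmxK.
Qed.

Lemma ker_proj_eq m (M : 'M[R]_(m, 3)) u v : \rank M = 2%N ->
  M *m u = 0 -> M *m v = 0 -> u != 0 -> v != 0 -> proj_eq u v.
Proof.
move=> rM Mu Mv u0 v0; have [c] := rank2_ker rM Mu Mv v0.
exact: proj_eq_scale.
Qed.

Lemma det0_col n (M : 'M[R]_n) : \det M = 0 -> exists2 v : 'cV[R]_n, v != 0 & M *m v = 0.
Proof.
move=> dM; have /det0P[v v0 vM] : \det M^T == 0 by rewrite det_tr dM.
exists v^T; first by rewrite -trmx0 (inj_eq trmx_inj).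
by rewrite -[M]trmxK -trmx_mul vM trmx0.
Qed.

Lemma col_det0 n (M : 'M[R]_n) (v : 'cV[R]_n) : v != 0 -> M *m v = 0 -> \det M = 0.
Proof.
move=> v0 Mv; rewrite -det_tr; apply/eqP/det0P; exists v^T.
  by rewrite -trmx0 (inj_eq trmx_inj).
by rewrite -trmx_mul Mv trmx0.
Qed.

Lemma row_det0 n (M : 'M[R]_n) (v : 'cV[R]_n) : v != 0 -> v^T *m M = 0 -> \det M = 0.
Proof.
by move=> v0 vM; rewrite -det_tr (col_det0 v0) // -[v]trmxK -trmx_mul vM trmx0.
Qed.

Lemma rank_fact m n (M : 'M[R]_(m, n)) r : \rank M = r ->
  exists U : 'M[R]_(m, r), exists V : 'M[R]_(r, n),
    [/\ M = U *m V, \rank U = r & \rank V = r].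
Proof.
move=> <-; exists (col_base M), (row_base M); rewrite mulmx_base; split=> //.
  exact/eqP/col_base_full.
exact/eqP/row_base_free.
Qed.

Lemma det0_rank2 F : \det F = 0 -> F != 0 -> \rank F != 1%N -> \rank F = 2%N.
Proof.
move=> dF F0 F1; have := rank_leq_row F; rewrite leq_eqVlt.
case/orP=> [rF|].
  have : F \in unitmx by rewrite -row_free_unit.
  by rewrite unitmxE dF unitr0.
by move: F0 F1; rewrite -mxrank_eq0; case: (\rank F) => [|[|[|]]].
Qed.

Definition bil F x y : R := (x^T *m F *m y) 0 0.

Lemma bilE F x y : bil F x y =
  \sum_i \sum_j x i 0 * F i j * y j 0.
Proof.
rewrite /bil -mulmxA mxE; apply: eq_bigr => i _; rewrite !mxE mulr_sumr.
by apply: eq_bigr => j _; rewrite mulrA.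
Qed.

Lemma bilB F G c x y : bil (F - c *: G) x y = bil F x y - c * bil G x y.
Proof. by rewrite /bil mulmxBr mulmxBl -scalemxAr -scalemxAl !mxE. Qed.

Definition epipolar n (X Y : 'M[R]_(3, n)) F :=
  forall i, bil F (col i X) (col i Y) = 0.
End Space.

(** * Pairs of cameras and their epipolar forms *)

Section Epipolar.
Variable R : realType.
Implicit Types (a b : 'cV[R]_3) (F : 'M[R]_3).

Definition wedge : 'M[R]_2 := \matrix_(i, j) (j%:R - i%:R).

Lemma sum2 (V : nmodType) (E : 'I_2 -> V) : \sum_i E i = E ord0 + E ord_max.
Proof.
by rewrite !big_ord_recr big_ord0 /= add0r; congr (E _ + E _); apply: val_inj.
Qed.

Lemma col2P (p q : 'cV[R]_2) : p ord0 0 = q ord0 0 -> p ord_max 0 = q ord_max 0 -> p = q.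
Proof.
move=> h0 h1; apply/matrixP => -[[|[|i]] Hi] j //; rewrite (ord1 j).
  by rewrite (_ : Ordinal Hi = ord0) //; apply: val_inj.
by rewrite (_ : Ordinal Hi = ord_max) //; apply: val_inj.
Qed.

Lemma wedgeE (p q : 'cV[R]_2) :
  (p^T *m wedge *m q) 0 0 = p ord0 0 * q ord_max 0 - p ord_max 0 * q ord0 0.
Proof. by rewrite mxE sum2 !mxE !sum2 !mxE /=; ring. Qed.

Lemma wedge_proj_eq (p q : 'cV[R]_2) : p != 0 -> q != 0 ->
  (p^T *m wedge *m q) 0 0 = 0 <-> proj_eq p q.
Proof.
move=> p0 q0; rewrite wedgeE; split=> [pq|[c _ ->]]; last by rewrite !mxE; ring.
have [q00|q00] := eqVneq (q ord0 0) 0.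
  have q10 : q ord_max 0 != 0.
    by apply: contra_neq q0 => q10; apply: col2P; rewrite ?q00 ?q10 mxE.
  apply: (@proj_eq_scale _ _ _ _ (p ord_max 0 / q ord_max 0)) => //.
  apply: col2P; rewrite !mxE ?divfK // q00 mulr0.
  by apply: (mulIf q10); rewrite mul0r; rewrite q00 in pq; lra.
apply: (@proj_eq_scale _ _ _ _ (p ord0 0 / q ord0 0)) => //.
apply: col2P; rewrite !mxE ?divfK //.
by apply: (mulIf q00); rewrite mulrAC divfK //; lra.
Qed.

Lemma wedge_tr : wedge *m wedge^T = 1%:M.
Proof.
have col i : col i (wedge *m wedge^T) = col i 1%:M.
  apply: col2P; rewrite !mxE sum2 !mxE;
  by case: i => [[|[|i]] Hi] //; rewrite -!val_eqE /= -?val_eqE /=; ring.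
by apply/matrixP => i j; have /matrixP/(_ i 0) := col j; rewrite !mxE.
Qed.

Lemma wedge_unit : wedge \in unitmx.
Proof. by have [] := mulmx1_unit wedge_tr. Qed.

(** A pair of cameras is recorded by its epipolar form [A^T *m wedge *m B]:
    two image vectors in the plane are proportional exactly when their wedge
    vanishes, the two kernels of the form are the centers, and conversely any
    rank 2 form splits as such a product. *)
Lemma center_locusP n (X Y : 'M[R]_(3, n)) a b :
  point_tuple X -> point_tuple Y ->
  center_locus X Y a b <->
  [/\ a != 0, b != 0, forall i, ~ proj_eq (col i X) a,
      forall i, ~ proj_eq (col i Y) b
    & exists F, [/\ \rank F = 2%N, F^T *m a = 0, F *m b = 0 & epipolar X Y F]].
Proof.
move=> pX pY; split.
- case=> A [B [rA rB [a0 Aa] [b0 Bb] im]]; split=> //.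
  + move=> i [c _ xE]; have [+ _ _] := im i.
    by rewrite xE -scalemxAr Aa scaler0 eqxx.
  + move=> i [c _ xE]; have [_ + _] := im i.
    by rewrite xE -scalemxAr Bb scaler0 eqxx.
  exists (A^T *m wedge *m B); split.
  + rewrite mxrankMfree /row_free ?rB // -mxrank_tr trmx_mul trmxK.
    rewrite mxrankMfree /row_free ?rA // mxrank_tr; apply/eqP.
    by rewrite -[_ == _]/(row_free _) row_free_unit wedge_unit.
  + by rewrite !trmx_mul trmxK -!mulmxA Aa !mulmx0.
  + by rewrite -!mulmxA Bb !mulmx0.
  + move=> i; rewrite /bil; have [Ax By /wedge_proj_eq-/(_ Ax By)] := im i.
    by rewrite trmx_mul !mulmxA.
- case=> a0 b0 xa yb [F [rF Fa Fb ep]].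
  have [U [V [FE rU rV]]] := rank_fact rF.
  have fU : row_free U^T by rewrite /row_free mxrank_tr rU.
  have fV : row_free V by rewrite /row_free rV.
  have FA : F = ((U *m wedge^T)^T)^T *m wedge *m V.
    by rewrite trmxK -[U *m _ *m _]mulmxA (mulmx1C wedge_tr) mulmx1.
  have rA : \rank (U *m wedge^T)^T = 2%N.
    rewrite mxrank_tr mxrankMfree // row_free_unit unitmx_tr; exact: wedge_unit.
  have Aa : (U *m wedge^T)^T *m a = 0.
    apply: trmx_inj; rewrite trmx_mul trmxK trmx0 mulmxA.
    suff -> : a^T *m U = 0 by rewrite mul0mx.
    apply/eqP; rewrite -(mulmx_free_eq0 _ fV) -mulmxA -FE.
    by rewrite -[F]trmxK -trmx_mul Fa trmx0.
  have Vb : V *m b = 0.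
    apply: trmx_inj; rewrite trmx0; apply/eqP.
    by rewrite -(mulmx_free_eq0 _ fU) -trmx_mul mulmxA -FE Fb trmx0.
  exists ((U *m wedge^T)^T), V; split=> // i.
  have Ax : (U *m wedge^T)^T *m col i X != 0.
    apply/eqP => Ax; apply: (xa i); exact: ker_proj_eq rA Ax Aa (pX i) a0.
  have Vy : V *m col i Y != 0.
    apply/eqP => By; apply: (yb i); exact: ker_proj_eq rV By Vb (pY i) b0.
  split=> //; apply/wedge_proj_eq => //.
  by have := ep i; rewrite /bil {1}FA !trmx_mul !trmxK !mulmxA.
Qed.

Lemma center_locusC n (X Y : 'M[R]_(3, n)) a b :
  center_locus X Y a b -> center_locus Y X b a.
Proof.
case=> A [B [rA rB Aa Bb im]]; exists B, A; split=> // i.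
by have [Ax By /proj_eq_sym] := im i.
Qed.

Lemma center_locusM n (X Y : 'M[R]_(3, n)) a b (N M : 'M[R]_3) :
  N \in unitmx -> M \in unitmx ->
  center_locus (N *m X) (M *m Y) (N *m a) (M *m b) <-> center_locus X Y a b.
Proof.
have imp (N' M' : 'M[R]_3) (X' Y' : 'M[R]_(3, n)) a' b' :
    N' \in unitmx -> M' \in unitmx -> center_locus X' Y' a' b' ->
    center_locus (N' *m X') (M' *m Y') (N' *m a') (M' *m b').
  move=> uN uM [A [B [rA rB [a0 Aa] [b0 Bb] im]]].
  have nz (L : 'M[R]_3) (v : 'cV[R]_3) : L \in unitmx -> v != 0 -> L *m v != 0.
    by move=> uL; apply: contra_neq => /(congr1 (mulmx (invmx L)));
       rewrite mulKmx // mulmx0.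
  exists (A *m invmx N'), (B *m invmx M'); split.
  - by rewrite /flatland_camera mxrankMfree // row_free_unit unitmx_inv.
  - by rewrite /flatland_camera mxrankMfree // row_free_unit unitmx_inv.
  - by split; rewrite ?nz // -mulmxA mulKmx.
  - by split; rewrite ?nz // -mulmxA mulKmx.
  - by move=> i; rewrite !colE -!mulmxA !mulKmx // -!colE; exact: im.
move=> uN uM; split; last exact: imp.
have uN' : invmx N \in unitmx by rewrite unitmx_inv.
have uM' : invmx M \in unitmx by rewrite unitmx_inv.
by move=> /(imp _ _ _ _ _ _ uN' uM'); rewrite !mulKmx.
Qed.
End Epipolar.

(** * Polynomial conditions on tuples of points *)

Section Generic.
Variable R : realType.

Definition polyfun n (phi : 'M[R]_(3, n) -> 'M[R]_(3, n) -> R) :=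
  exists p : {mpoly R[(3 + 3) * n]},
    forall X Y, p.@[fun k => mxvec (col_mx X Y) 0 k] = phi X Y.

Definition polymx n p q
    (M : 'M[R]_(3, n) -> 'M[R]_(3, n) -> 'M[R]_(p, q)) :=
  forall i j, polyfun (fun X Y => M X Y i j).

Section Closure.
Variable n : nat.
Implicit Types phi psi : 'M[R]_(3, n) -> 'M[R]_(3, n) -> R.

Lemma polyfun_ext phi psi : (forall X Y, phi X Y = psi X Y) ->
  polyfun phi -> polyfun psi.
Proof. by move=> e [p pE]; exists p => X Y; rewrite pE. Qed.

Lemma polyfun_cst c : polyfun (fun _ _ : 'M[R]_(3, n) => c).
Proof. by exists c%:MP => X Y; rewrite mevalC. Qed.

Lemma polyfunD phi psi : polyfun phi -> polyfun psi ->
  polyfun (fun X Y => phi X Y + psi X Y).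
Proof. by move=> [p pE] [q qE]; exists (p + q) => X Y; rewrite mevalD pE qE. Qed.

Lemma polyfunM phi psi : polyfun phi -> polyfun psi ->
  polyfun (fun X Y => phi X Y * psi X Y).
Proof. by move=> [p pE] [q qE]; exists (p * q) => X Y; rewrite mevalM pE qE. Qed.

Lemma polyfunN phi : polyfun phi -> polyfun (fun X Y => - phi X Y).
Proof. by move=> [p pE]; exists (- p) => X Y; rewrite mevalN pE. Qed.

Lemma polyfun_sum (I : Type) (r : seq I) P (E : I -> 'M[R]_(3, n) -> 'M[R]_(3, n) -> R) :
  (forall i, polyfun (E i)) -> polyfun (fun X Y => \sum_(i <- r | P i) E i X Y).
Proof.
move=> pE; elim: r => [|i r IH].
  apply: (@polyfun_ext (fun _ _ => 0)); last exact: polyfun_cst.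
  by move=> X Y; rewrite big_nil.
case Pi: (P i).
  apply: (polyfun_ext _ (polyfunD (pE i) IH)) => X Y.
  by rewrite big_cons Pi.
by apply: (polyfun_ext _ IH) => X Y; rewrite big_cons Pi.
Qed.

Lemma polyfun_prod (I : Type) (r : seq I) P (E : I -> 'M[R]_(3, n) -> 'M[R]_(3, n) -> R) :
  (forall i, polyfun (E i)) -> polyfun (fun X Y => \prod_(i <- r | P i) E i X Y).
Proof.
move=> pE; elim: r => [|i r IH].
  apply: (@polyfun_ext (fun _ _ => 1)); last exact: polyfun_cst.
  by move=> X Y; rewrite big_nil.
case Pi: (P i).
  apply: (polyfun_ext _ (polyfunM (pE i) IH)) => X Y.
  by rewrite big_cons Pi.
by apply: (polyfun_ext _ IH) => X Y; rewrite big_cons Pi.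
Qed.

Lemma polymx_cst p q (C : 'M[R]_(p, q)) : polymx (fun _ _ : 'M[R]_(3, n) => C).
Proof. by move=> i j; exact: polyfun_cst. Qed.

Lemma polymx_fst : polymx (fun X _ : 'M[R]_(3, n) => X).
Proof.
move=> i j; exists 'X_(mxvec_index (lshift 3 i) j) => X Y.
by rewrite mevalXU mxvecE col_mxEu.
Qed.

Lemma polymx_snd : polymx (fun _ Y : 'M[R]_(3, n) => Y).
Proof.
move=> i j; exists 'X_(mxvec_index (rshift 3 i) j) => X Y.
by rewrite mevalXU mxvecE col_mxEd.
Qed.

Lemma polymxM p q r (M : 'M[R]_(3, n) -> 'M[R]_(3, n) -> 'M[R]_(p, q))
    (N : 'M[R]_(3, n) -> 'M[R]_(3, n) -> 'M[R]_(q, r)) :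
  polymx M -> polymx N -> polymx (fun X Y : 'M[R]_(3, n) => M X Y *m N X Y).
Proof.
move=> pM pN i k.
apply: (@polyfun_ext (fun X Y => \sum_j M X Y i j * N X Y j k)).
  by move=> X Y; rewrite mxE.
by apply: polyfun_sum => j; apply: polyfunM.
Qed.

Lemma polyfun_det p (M : 'M[R]_(3, n) -> 'M[R]_(3, n) -> 'M[R]_p) :
  polymx M -> polyfun (fun X Y : 'M[R]_(3, n) => \det (M X Y)).
Proof.
move=> pM; apply: polyfun_sum => s; apply: polyfunM; first exact: polyfun_cst.
by apply: polyfun_prod => i.
Qed.

Lemma polymx_adj p (M : 'M[R]_(3, n) -> 'M[R]_(3, n) -> 'M[R]_p) :
  polymx M -> polymx (fun X Y : 'M[R]_(3, n) => \adj (M X Y)).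
Proof.
move=> pM i j.
apply: (@polyfun_ext (fun X Y => cofactor (M X Y) j i)).
  by move=> X Y; rewrite mxE.
apply: polyfunM; first exact: polyfun_cst.
apply: polyfun_det => k l.
by apply: polyfun_ext (pM (lift j k) (lift i l)) => X Y; rewrite !mxE.
Qed.

Lemma generic_mono (P Q : 'M[R]_(3, n) -> 'M[R]_(3, n) -> Prop) :
  (forall X Y, point_tuple X -> point_tuple Y -> P X Y -> Q X Y) ->
  for_generic_tuples P -> for_generic_tuples Q.
Proof.
by move=> PQ [p p0 pP]; exists p => // X Y pX pY pXY; apply: PQ => //; exact: pP.
Qed.

Lemma generic_and (P Q : 'M[R]_(3, n) -> 'M[R]_(3, n) -> Prop) :
  for_generic_tuples P -> for_generic_tuples Q ->
  for_generic_tuples (fun X Y => P X Y /\ Q X Y).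
Proof.
move=> [p p0 pP] [q q0 qQ]; exists (p * q); first by rewrite mulf_neq0.
move=> X Y pX pY; rewrite mevalM mulf_eq0 negb_or => /andP[pXY qXY].
by split; [exact: pP | exact: qQ].
Qed.

Lemma generic_all (I : finType) (P : I -> 'M[R]_(3, n) -> 'M[R]_(3, n) -> Prop) :
  (forall i, for_generic_tuples (P i)) ->
  for_generic_tuples (fun X Y => forall i, P i X Y).
Proof.
move=> gP.
suff /(_ (enum I)) : forall s : seq I,
    for_generic_tuples (fun X Y => forall i, i \in s -> P i X Y).
  apply: generic_mono => X Y _ _ H i; apply: H; exact: mem_enum.
elim=> [|i s IH]; first by exists 1; rewrite ?oner_eq0.
apply: generic_mono (generic_and (gP i) IH) => X Y _ _ [Pi Ps] j.
by rewrite inE => /orP[/eqP->|/Ps].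
Qed.

Lemma generic_polyfun phi X0 Y0 : polyfun phi -> phi X0 Y0 != 0 ->
  for_generic_tuples (fun X Y => phi X Y != 0).
Proof.
move=> [p pE] phi0; exists p; last by move=> X Y _ _; rewrite pE.
by apply: contra_neq phi0 => p0; rewrite -pE p0 meval0.
Qed.

End Closure.

(** Serves to impose a condition on normalized or completed tuples, and to
    exchange the roles of the two tuples. *)
Lemma polyfun_comp m n (phi : 'M[R]_(3, m) -> 'M[R]_(3, m) -> R)
    (M N : 'M[R]_(3, n) -> 'M[R]_(3, n) -> 'M[R]_(3, m)) :
  polyfun phi -> polymx M -> polymx N -> polyfun (fun X Y => phi (M X Y) (N X Y)).
Proof.
case=> p pE pM pN.
have [f fE] := boolp.choice (fun ij => pM ij.1 ij.2).
have [g gE] := boolp.choice (fun ij => pN ij.1 ij.2).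
pose sub (k : 'I_((3 + 3) * m)) : {mpoly R[(3 + 3) * n]} :=
  (mxvec (col_mx (\matrix_(i, j) f (i, j)) (\matrix_(i, j) g (i, j)))) 0 k.
exists (p \mPo [tuple sub k | k < (3 + 3) * m]) => X Y.
rewrite comp_mpoly_meval -pE; apply: meval_eq => k; rewrite tnth_mktuple /sub.
case/mxvec_indexP: k => i j; rewrite !mxvecE.
case: (splitP i) => k kE.
  rewrite (_ : i = lshift 3 k); last exact: val_inj.
  by rewrite !col_mxEu mxE fE.
rewrite (_ : i = rshift 3 k); last exact: val_inj.
by rewrite !col_mxEd mxE gE.
Qed.

Lemma generic_polyfun_swap n (phi : 'M[R]_(3, n) -> 'M[R]_(3, n) -> R) X0 Y0 :
  polyfun phi -> phi X0 Y0 != 0 ->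
  for_generic_tuples (fun X Y => phi X Y != 0 /\ phi Y X != 0).
Proof.
move=> pphi phi0; apply: generic_and; first exact: generic_polyfun phi0.
apply: (@generic_polyfun _ (fun X Y => phi Y X) Y0 X0) => //.
exact: polyfun_comp pphi (@polymx_snd n) (@polymx_fst n).
Qed.

Lemma polymx_vec3 n (r s t : 'M[R]_(3, n) -> 'M[R]_(3, n) -> R) :
  polyfun r -> polyfun s -> polyfun t ->
  polymx (fun X Y => vec3 (r X Y) (s X Y) (t X Y)).
Proof.
move=> pr ps pt i j.
elim/ord3_ind: i.
- by apply: polyfun_ext pr => X Y; rewrite mxE.
- by apply: polyfun_ext ps => X Y; rewrite mxE.
- by apply: polyfun_ext pt => X Y; rewrite mxE.
Qed.

Lemma polymx_cross n (u v : 'M[R]_(3, n) -> 'M[R]_(3, n) -> 'cV[R]_3) :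
  polymx u -> polymx v -> polymx (fun X Y => cross (u X Y) (v X Y)).
Proof.
move=> pu pv; apply: polymx_vec3; apply: polyfunD; try apply: polyfunN;
  apply: polyfunM; by [exact: pu | exact: pv].
Qed.

Lemma polymx_hadamard n (u v : 'M[R]_(3, n) -> 'M[R]_(3, n) -> 'cV[R]_3) :
  polymx u -> polymx v -> polymx (fun X Y => hadamard (u X Y) (v X Y)).
Proof.
move=> pu pv i j; apply: polyfun_ext (polyfunM (pu i 0) (pv i 0)) => X Y.
by rewrite mxE.
Qed.

Lemma polymx_col n p q (M : 'M[R]_(3, n) -> 'M[R]_(3, n) -> 'M[R]_(p, q)) j :
  polymx M -> polymx (fun X Y => col j (M X Y)).
Proof. by move=> pM i k; apply: polyfun_ext (pM i j) => X Y; rewrite mxE. Qed.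

Lemma polyfun_prod3 n (u : 'M[R]_(3, n) -> 'M[R]_(3, n) -> 'cV[R]_3) :
  polymx u -> polyfun (fun X Y => \prod_k u X Y k 0).
Proof. by move=> pu; apply: polyfun_prod => k. Qed.

(** Completing (or truncating) a tuple to [m] columns makes a condition on [m]
    points meaningful for tuples of any length.  When the completion is by a
    configuration [X0] at which the condition holds, the condition is generic
    for every length, see [pad_pad]. *)
Definition pad m n (X0 : 'M[R]_(3, m)) (X : 'M[R]_(3, n)) : 'M[R]_(3, m) :=
  \matrix_(i, k) if insub (val k) is Some k' then X i k' else X0 i k.

Lemma polymx_pad m n (X0 : 'M[R]_(3, m)) (M : _ -> _ -> 'M[R]_(3, n)) :
  polymx M -> polymx (fun X Y : 'M[R]_(3, n) => pad X0 (M X Y)).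
Proof.
move=> pM i k; case E: (insub (val k) : option 'I_n) => [k'|].
  by apply: polyfun_ext (pM i k') => X Y; rewrite mxE E.
by apply: polyfun_ext (polyfun_cst n (X0 i k)) => X Y; rewrite mxE E.
Qed.

Lemma pad_pad m n (X0 : 'M[R]_(3, m)) : pad X0 (pad (0 : 'M[R]_(3, n)) X0) = X0.
Proof.
apply/matrixP => i k; rewrite mxE; case: insubP => // k' _ k'E.
rewrite mxE; case: insubP => [k'' _ k''E|]; last by rewrite k'E ltn_ord.
by congr (X0 i _); apply: val_inj; rewrite k''E k'E.
Qed.

Lemma col_pad m n (X0 : 'M[R]_(3, m)) (X : 'M[R]_(3, n)) (k : 'I_m) (i : 'I_n) :
  k = i :> nat -> col k (pad X0 X) = col i X.
Proof.
move=> ki; apply/matrixP => r c; rewrite !mxE.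
case: insubP => [k' _ k'E|]; last by rewrite /= ki ltn_ord.
by congr (X r _); apply: val_inj; rewrite k'E.
Qed.
End Generic.

(** * Forms and curves in the plane *)

Lemma prod3 (S : comPzSemiRingType) (E : 'I_3 -> S) : \prod_i E i = E o0 * E o1 * E o2.
Proof.
rewrite !big_ord_recr big_ord0 /= mul1r.
by congr (E _ * E _ * E _); apply: val_inj.
Qed.

Section Forms.
Variable R : realType.
Implicit Types (a b u v : 'cV[R]_3) (N M : 'M[R]_3) (phi psi : 'cV[R]_3 -> R).

Definition hform d phi :=
  exists2 p : {mpoly R[3]}, p \is d.-homog & forall a, p.@[fun k => a k 0] = phi a.

Lemma hform_ext d phi psi : (forall a, phi a = psi a) -> hform d phi -> hform d psi.
Proof. by move=> e [p hp pE]; exists p => // a; rewrite pE. Qed.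

Lemma hform_cst c : hform 0 (fun _ => c).
Proof.
exists c%:MP; last by move=> a; rewrite mevalC.
by rewrite -[c%:MP]mulr1 mul_mpolyC; apply: dhomogZ; exact: dhomog1.
Qed.

Lemma hform_coord i : hform 1 (fun a => a i 0).
Proof. by exists 'X_i; [rewrite dhomogX /= mdeg1 | move=> a; rewrite mevalXU]. Qed.

Lemma hformD d phi psi : hform d phi -> hform d psi -> hform d (fun a => phi a + psi a).
Proof.
move=> [p hp pE] [q hq qE]; exists (p + q); first exact: rpredD.
by move=> a; rewrite mevalD pE qE.
Qed.

Lemma hformM d e phi psi : hform d phi -> hform e psi ->
  hform (d + e) (fun a => phi a * psi a).
Proof.
move=> [p hp pE] [q hq qE]; exists (p * q); first exact: dhomogM.
by move=> a; rewrite mevalM pE qE.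
Qed.

Lemma hformZ d c phi : hform d phi -> hform d (fun a => c * phi a).
Proof. by move=> h; exact: hformM (hform_cst c) h. Qed.

Lemma hformN d phi : hform d phi -> hform d (fun a => - phi a).
Proof. by move=> h; apply: hform_ext (hformZ (-1) h) => a; rewrite mulN1r. Qed.

Lemma hformB d phi psi : hform d phi -> hform d psi -> hform d (fun a => phi a - psi a).
Proof. by move=> h k; apply: hformD => //; exact: hformN. Qed.

Lemma plane_formP d phi a0 : hform d phi -> phi a0 != 0 ->
  exists2 f : {mpoly R[3]}, plane_form d f & forall a, f.@[fun k => a k 0] = phi a.
Proof.
case=> p hp pE phi0; exists p => //; split=> //.
by apply: contra_neq phi0 => p0; rewrite -pE p0 meval0.
Qed.

Lemma nonroot (p : {poly R}) : p != 0 -> exists t, p.[t] != 0.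
Proof.
move=> p0; apply: boolp.contrapT => none.
have: (size [seq k%:R : R | k <- iota 0 (size p)] < size p)%N.
  apply: max_poly_roots => //.
    by apply/allP => t _; apply: boolp.contrapT => /negP pt; apply: none; exists t.
  rewrite map_inj_uniq ?iota_uniq // => i j /eqP.
  by rewrite eqr_nat => /eqP.
by rewrite size_map size_iota ltnn.
Qed.

Definition top_coef d (p : {poly R}) c := (size p <= d.+1)%N /\ p`_d = c.

Lemma top_coefM d e p q c k : top_coef d p c -> top_coef e q k ->
  top_coef (d + e) (p * q) (c * k).
Proof.
move=> [sp pd] [sq qe]; split.
  apply: leq_trans (size_polyMleq p q) _.
  by have := leq_add sp sq; case: (size p + size q)%N => //= n; rewrite addSn addnS.
have lt : (d < (d + e).+1)%N by rewrite ltnS leq_addr.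
rewrite coefM (bigD1 (Ordinal lt)) //= addKn pd qe big1 ?addr0 // => -[j jd] /=.
rewrite -val_eqE /= neq_ltn => /orP[jlt|jgt].
  rewrite [q`__]nth_default ?mulr0 //; apply: leq_trans sq _.
  by rewrite ltn_subRL ltn_add2r.
by rewrite [p`__]nth_default ?mul0r //; apply: leq_trans sp _.
Qed.

Lemma top_coef_lin (r s : R) : top_coef 1 (r%:P + s *: 'X) s.
Proof.
split; last by rewrite coefD coefC coefZ coefX /= mulr1 add0r.
apply: leq_trans (size_polyD _ _) _; rewrite geq_max.
apply/andP; split; first exact: leq_trans (size_polyC_leq1 _) _.
by apply: leq_trans (size_scale_leq _ _) _; rewrite size_polyX.
Qed.

Lemma top_coefX d p c k : top_coef d p c -> top_coef (d * k) (p ^+ k) (c ^+ k).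
Proof.
move=> h; elim: k => [|k IH].
  by rewrite muln0 !expr0; split; rewrite ?size_poly1 // coef1.
by rewrite mulnS !exprS; exact: top_coefM.
Qed.

(** The point at infinity [v] of the line [u + t v] is where the leading
    coefficient of the restricted form is read off. *)
Lemma form_on_line d (f : {mpoly R[3]}) u v : f \is d.-homog ->
  exists2 h : {poly R}, top_coef d h f.@[fun k => v k 0]
    & forall t, h.[t] = f.@[fun k => (u + t *: v) k 0].
Proof.
move=> /dhomogP hf.
exists (\sum_(m <- msupp f) f@_m *: \prod_i ((u i 0)%:P + v i 0 *: 'X) ^+ m i); last first.
  move=> t; rewrite mevalE horner_sum; apply: eq_bigr => m _.
  rewrite hornerZ horner_prod; congr (_ * _); apply: eq_bigr => i _.
  by rewrite horner_exp hornerD hornerC hornerZ hornerX !mxE mulrC.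
rewrite mevalE; elim: (msupp f) hf => [|m r IH] hf.
  by rewrite !big_nil; split; rewrite ?size_poly0 // coef0.
have [sr cr] : top_coef d _ _ := IH (fun j jr => hf j (@mem_behead _ (m :: r) j jr)).
have md := hf m (mem_head m r).
have dE : (1 * m o0 + 1 * m o1 + 1 * m o2)%N = d.
  by rewrite -md !mul1n /= mdegE sum3.
have [sm cm] : top_coef d (\prod_i ((u i 0)%:P + v i 0 *: 'X) ^+ m i)
                          (\prod_i v i 0 ^+ m i).
  rewrite -dE !prod3.
  by do 2?apply: top_coefM; apply: top_coefX; exact: top_coef_lin.
rewrite !big_cons; split.
  apply: leq_trans (size_polyD _ _) _; rewrite geq_max sr andbT.
  exact: leq_trans (size_scale_leq _ _) sm.
by rewrite coefD coefZ cm cr.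
Qed.

(** A line missing the given points meets a curve of odd degree, because a real
    polynomial of odd degree has a real root. *)
Lemma odd_curve_infinite d (f : {mpoly R[3]}) (s : seq 'cV[R]_3) :
  odd d -> f \is d.-homog -> exists2 a, on_curve f a & avoids s a.
Proof.
move=> oddd hf.
pose mom (c : 'cV[R]_3) : {poly R} := (c o0 0)%:P + (c o1 0) *: 'X + (c o2 0) *: 'X^2.
have [al al0] : exists al, (\prod_(c <- s | c != 0) mom c).[al] != 0.
  apply: nonroot; rewrite prodf_seq_neq0; apply/allP => c _; apply/implyP => c0.
  apply: contra_neq c0 => mc; apply: col3P; rewrite mxE.
  - by have /(congr1 (fun p : {poly R} => p`_0)) := mc;
      rewrite !(coefD, coefC, coefZ, coefX, coefXn) /= !mulr0 !addr0.
  - by have /(congr1 (fun p : {poly R} => p`_1)) := mc;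
      rewrite !(coefD, coefC, coefZ, coefX, coefXn) /= mulr0 mulr1 !(addr0, add0r).
  - by have /(congr1 (fun p : {poly R} => p`_2)) := mc;
      rewrite !(coefD, coefC, coefZ, coefX, coefXn) /= mulr0 mulr1 !(addr0, add0r).
(* [u] and [v] span the plane [c0 + al c1 + al^2 c2 = 0]. *)
pose u := vec3 (- al) 1 0; pose v := vec3 (- al ^+ 2) 0 1.
have miss a : a != 0 -> a o0 0 + al * a o1 0 + al ^+ 2 * a o2 0 = 0 -> avoids s a.
  move=> a0 aL c cs [k k0 aE]; have c0 : c != 0.
    by apply: contra_neq a0 => c0; rewrite aE c0 scaler0.
  move: al0; rewrite horner_prod prodf_seq_neq0 => /allP/(_ c cs).
  rewrite c0 /= !(hornerD, hornerC, hornerZ, hornerX, hornerXn) => /eqP; apply.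
  apply: (mulfI k0); rewrite mulr0 -aL aE !mxE; ring.
have [h [sh ch] hE] := form_on_line u v hf.
have [fv|fv] := eqVneq f.@[fun k => v k 0] 0.
  have v0 : v != 0 by apply: (@col_neq0 _ _ _ o2); rewrite mxE /= oner_eq0.
  by exists v => //; apply: miss => //; rewrite !mxE /=; ring.
have sE : size h = d.+1.
  apply/eqP; rewrite eqn_leq sh /=; apply: contraNT fv; rewrite -leqNgt => hd.
  by rewrite -ch nth_default.
have [|t /eqP ht] := @odd_poly_root R h; first by rewrite sE /= oddd.
have a0 : u + t *: v != 0.
  by apply: (@col_neq0 _ _ _ o1); rewrite !mxE /= mulr0 addr0 oner_eq0.
exists (u + t *: v); first by split; rewrite // -hE.
by apply: miss => //; rewrite !mxE /=; ring.
Qed.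

Lemma generic_point_hform d phi a0 : hform d phi -> phi a0 != 0 ->
  for_generic_point (fun a => phi a != 0).
Proof.
move=> hphi phi0; have [f pf fE] := plane_formP hphi phi0.
exists d, f; split=> // a an0 fa; apply/eqP => phia.
by apply: fa; split; rewrite // fE.
Qed.

Lemma generic_point_and (P Q : 'cV[R]_3 -> Prop) :
  for_generic_point P -> for_generic_point Q -> for_generic_point (fun a => P a /\ Q a).
Proof.
move=> [d [f [[f0 hf] fP]]] [e [g [[g0 hg] gP]]].
exists (d + e)%N, (f * g); split; first by split; rewrite ?mulf_neq0 // dhomogM.
move=> a a0 fga; split; [apply: fP | apply: gP] => // -[_ za]; apply: fga;
  by split; rewrite // mevalM za ?mul0r ?mulr0.
Qed.

Lemma generic_point_mono (P Q : 'cV[R]_3 -> Prop) :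
  (forall a, a != 0 -> P a -> Q a) -> for_generic_point P -> for_generic_point Q.
Proof.
move=> PQ [d [f [pf fP]]]; exists d, f; split=> // a a0 fa.
by apply: PQ => //; exact: fP.
Qed.

Definition hvec d (u : 'cV[R]_3 -> 'cV[R]_3) := forall k, hform d (fun a => u a k 0).

Lemma hvec_id : hvec 1 id.
Proof. by move=> k; exact: hform_coord. Qed.

Lemma hvec_cst v : hvec 0 (fun _ => v).
Proof. by move=> k; exact: hform_cst. Qed.

Lemma hvec_cross d e (u v : 'cV[R]_3 -> 'cV[R]_3) : hvec d u -> hvec e v ->
  hvec (d + e) (fun a => cross (u a) (v a)).
Proof.
move=> hu hv; have h i j k l : hform (d + e)
    (fun a => u a i 0 * v a j 0 - u a k 0 * v a l 0).
  by apply: hformB; apply: hformM.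
by elim/ord3_ind; [apply: hform_ext (h o1 o2 o2 o1) | apply: hform_ext (h o2 o0 o0 o2)
  | apply: hform_ext (h o0 o1 o1 o0)] => a; rewrite mxE.
Qed.

Lemma hvec_hadamard d e (u v : 'cV[R]_3 -> 'cV[R]_3) : hvec d u -> hvec e v ->
  hvec (d + e) (fun a => hadamard (u a) (v a)).
Proof. by move=> hu hv k; apply: hform_ext (hformM (hu k) (hv k)) => a; rewrite mxE. Qed.

Lemma generic_point_hvec d (u : 'cV[R]_3 -> 'cV[R]_3) a0 : hvec d u -> (forall k, u a0 k 0 != 0) ->
  for_generic_point (fun a => forall k, u a k 0 != 0).
Proof.
move=> hu u0; have h k := generic_point_hform (hu k) (u0 k).
apply: generic_point_mono (generic_point_and (h o0) (generic_point_and (h o1) (h o2))).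
by move=> a _ [h0 [h1 h2]]; elim/ord3_ind.
Qed.

Lemma generic_point_coords : for_generic_point (fun a => forall k, a k 0 != 0).
Proof.
apply: (generic_point_hvec (a0 := const_mx 1) hvec_id) => k.
by rewrite mxE oner_neq0.
Qed.

Lemma finite_of_unique (P : 'cV[R]_3 -> Prop) :
  (forall a a', P a -> P a' -> proj_eq a a') ->
  exists s, forall a, avoids s a -> ~ P a.
Proof.
move=> uP; have [[c Pc]|none] := boolp.pselect (exists c, P c).
  by exists [:: c] => a av Pa; apply: (av c); rewrite ?mem_head //; exact: uP.
by exists [::] => a _ Pa; apply: none; exists a.
Qed.

Lemma finite_forall (I : finType) (P : I -> 'cV[R]_3 -> Prop) :
  (forall i, exists s, forall a, avoids s a -> P i a) ->
  exists s, forall a, avoids s a -> forall i, P i a.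
Proof.
move=> /boolp.choice[s sP]; exists (flatten [seq s i | i <- enum I]) => a av i.
apply: sP => c cs; apply: av; apply/flattenP; exists (s i) => //.
by apply: map_f; exact: mem_enum.
Qed.

Definition linear_subst N : 3.-tuple {mpoly R[3]} :=
  [tuple \sum_j N i j *: 'X_j | i < 3].

Lemma linear_subst_meval N (f : {mpoly R[3]}) a :
  (f \mPo linear_subst N).@[fun k => a k 0] = f.@[fun k => (N *m a) k 0].
Proof.
rewrite comp_mpoly_meval; apply: meval_eq => i; rewrite tnth_mktuple raddf_sum mxE.
by apply: eq_bigr => j _; rewrite /= mevalZ mevalXU.
Qed.

(** Makes substitution by an invertible matrix reversible, so that a nonzero
    form stays nonzero. *)
Lemma linear_substM N M (f : {mpoly R[3]}) :
  (f \mPo linear_subst N) \mPo linear_subst M = f \mPo linear_subst (N *m M).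
Proof.
rewrite [f \mPo linear_subst N]comp_mpolyEX [RHS]comp_mpolyEX raddf_sum; apply: eq_bigr => m _.
rewrite /= !comp_mpolyZ !comp_mpolyX rmorph_prod; congr (_ *: _).
apply: eq_bigr => i _; rewrite rmorphXn; congr (_ ^+ _).
rewrite /= !tnth_mktuple raddf_sum.
rewrite (eq_bigr (fun j => \sum_k (N i j * M j k) *: 'X_k)); last first.
  move=> j _; rewrite /= comp_mpolyZ comp_mpolyXU -tnth_nth tnth_mktuple scaler_sumr.
  by apply: eq_bigr => k _; rewrite scalerA.
rewrite exchange_big; apply: eq_bigr => k _.
by rewrite -scaler_suml; congr (_ *: _); rewrite mxE.
Qed.

Lemma linear_subst1 (f : {mpoly R[3]}) : f \mPo linear_subst 1%:M = f.
Proof.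
rewrite -[RHS]comp_mpoly_id; congr (_ \mPo _); apply: eq_from_tnth => i.
rewrite !tnth_mktuple (bigD1 i) //= mxE eqxx scale1r big1 ?addr0 // => j ji.
by rewrite mxE eq_sym (negbTE ji) scale0r.
Qed.

Lemma linear_subst_homog d N (f : {mpoly R[3]}) :
  f \is d.-homog -> f \mPo linear_subst N \is d.-homog.
Proof.
move=> /dhomogP hf; rewrite comp_mpolyE big_seq; apply: rpred_sum => m /hf md.
apply: dhomogZ; rewrite prod3.
have lin i : tnth (linear_subst N) i \is 1.-homog.
  rewrite tnth_mktuple; apply: rpred_sum => j _; apply: dhomogZ.
  by rewrite dhomogX /= mdeg1.
have -> : d = (1 * m o0 + 1 * m o1 + 1 * m o2)%N by rewrite -md !mul1n /= mdegE sum3.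
by do 2?apply: dhomogM; apply: dhomogMn.
Qed.

Lemma plane_form_subst d (f : {mpoly R[3]}) N : N \in unitmx -> plane_form d f ->
  exists2 g : {mpoly R[3]}, plane_form d g
    & forall a, on_curve g a <-> on_curve f (N *m a).
Proof.
move=> uN [f0 hf]; exists (f \mPo linear_subst N).
  split; last exact: linear_subst_homog.
  apply: contra_neq f0 => fN0.
  by rewrite -[f]linear_subst1 -(mulmxV uN) -linear_substM fN0 comp_mpoly0.
move=> a; rewrite /on_curve linear_subst_meval; split=> -[a0 fa]; split=> //.
  by apply: contra_neq a0 => /(congr1 (mulmx (invmx N))); rewrite mulKmx // mulmx0.
by apply: contra_neq a0 => ->; rewrite mulmx0.
Qed.
End Forms.

(** * Coordinates in which the first three points are standard *)

Section Coordinates.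
Variable R : realType.
Implicit Types (a b g x y u v : 'cV[R]_3) (F N M : 'M[R]_3).

Lemma mulmx_neq0 N v : N \in unitmx -> v != 0 -> N *m v != 0.
Proof.
by move=> uN; apply: contra_neq => /(congr1 (mulmx (invmx N))); rewrite mulKmx // mulmx0.
Qed.

Lemma proj_eq_unit N u v : N \in unitmx -> proj_eq (N *m u) (N *m v) <-> proj_eq u v.
Proof.
by move=> uN; split=> [/(proj_eqM (invmx N))|/proj_eqM//]; rewrite !mulKmx.
Qed.

Lemma generic_point_subst N (P : 'cV[R]_3 -> Prop) : N \in unitmx ->
  for_generic_point P -> for_generic_point (fun a => P (N *m a)).
Proof.
move=> uN [d [f [/(plane_form_subst uN)[h hd hE] fP]]]; exists d, h; split=> // a a0 ha.
by apply: fP; [exact: mulmx_neq0 | move=> /hE].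
Qed.

Lemma avoids_map N (s : seq 'cV[R]_3) a : N \in unitmx ->
  avoids (map (mulmx N) s) (N *m a) <-> avoids s a.
Proof.
move=> uN; split=> av c.
  by move=> cs /(proj_eqM N); apply: av; exact: map_f.
by case/mapP => d ds -> /proj_eq_unit-/(_ uN); exact: av.
Qed.

Lemma generic_point_on_subst N (P : 'cV[R]_3 -> Prop) (f h : {mpoly R[3]}) :
  N \in unitmx -> (forall a, on_curve h a <-> on_curve f (N *m a)) ->
  for_generic_point_on f P -> for_generic_point_on h (fun a => P (N *m a)).
Proof.
move=> uN hE [inf [s sP]]; split.
  move=> t; have [a fa ta] := inf (map (mulmx N) t).
  exists (invmx N *m a); first by apply/hE; rewrite mulKVmx.
  by apply/(avoids_map _ _ uN); rewrite mulKVmx.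
exists (map (mulmx (invmx N)) s) => a /hE fa sa; apply: sP => //.
apply/(@avoids_map (invmx N)); first by rewrite unitmx_inv.
by rewrite mulKmx.
Qed.

Lemma fills_conic_subst N (P : 'cV[R]_3 -> Prop) : N \in unitmx ->
  fills_conic P -> fills_conic (fun a => P (N *m a)).
Proof.
move=> uN [q [/(plane_form_subst uN)[h hd hE] Pq gP]]; exists h; split=> //.
  by move=> b /Pq /hE.
exact: generic_point_on_subst gP.
Qed.

Lemma unique_point_subst N (P : 'cV[R]_3 -> Prop) : N \in unitmx ->
  unique_point P -> unique_point (fun a => P (N *m a)).
Proof.
move=> uN [b Pb bu]; exists (invmx N *m b); first by rewrite mulKVmx.
by move=> b' /bu; rewrite -{1}[b](mulKVmx uN) => /proj_eq_unit; apply.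
Qed.

Definition frame n (X : 'M[R]_(3, n)) : 'M[R]_3 := pad 1%:M X.

(** The adjugate stands for the inverse, so that the normalized points are
    polynomial in the given ones; projectively this changes nothing. *)
Definition to_frame n (X : 'M[R]_(3, n)) : 'M[R]_3 := \adj (frame X).
Definition normalize n (X : 'M[R]_(3, n)) : 'M[R]_(3, n) := to_frame X *m X.

Definition normalized n (X : 'M[R]_(3, n)) :=
  forall (i : 'I_n) (k : 'I_3), i = k :> nat ->
  exists2 c, c != 0 & col i X = c *: delta_mx k 0.

Lemma to_frame_unit n (X : 'M[R]_(3, n)) : \det (frame X) != 0 -> to_frame X \in unitmx.
Proof.
move=> d; rewrite unitmxE; have := congr1 determinant (mul_adj_mx (frame X)).
rewrite det_mulmx det_scalar unitfE => h; apply: contra_neq d => t0.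
by move: h; rewrite -/(to_frame X) t0 mul0r => /esym/eqP; rewrite expf_eq0 => /eqP.
Qed.

Lemma normalize_normalized n (X : 'M[R]_(3, n)) :
  \det (frame X) != 0 -> normalized (normalize X).
Proof.
move=> d i k ik; exists (\det (frame X)) => //.
rewrite /normalize colE -mulmxA -colE -(@col_pad _ _ _ 1%:M X k i) //.
rewrite -/(frame X) colE mulmxA mul_adj_mx mul_scalar_mx //.
Qed.

Lemma point_tuple_normalize n (X : 'M[R]_(3, n)) :
  \det (frame X) != 0 -> point_tuple X -> point_tuple (normalize X).
Proof.
move=> d pX i; rewrite /normalize colE -mulmxA -colE.
by apply: mulmx_neq0 => //; exact: to_frame_unit.
Qed.

Lemma locus_normalize n (X Y : 'M[R]_(3, n)) :
  \det (frame X) != 0 -> \det (frame Y) != 0 ->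
  center_locus X Y = fun a b =>
  center_locus (normalize X) (normalize Y) (to_frame X *m a) (to_frame Y *m b).
Proof.
move=> dX dY; apply: boolp.funext => a; apply: boolp.funext => b; apply: boolp.propext.
by rewrite center_locusM ?to_frame_unit.
Qed.

Lemma generic_frame n : for_generic_tuples (fun X Y : 'M[R]_(3, n) =>
  \det (frame X) != 0 /\ \det (frame Y) != 0).
Proof.
apply: (@generic_polyfun_swap _ _ _ (pad 0 1%:M) 0).
  by apply/polyfun_det/polymx_pad/polymx_fst.
by rewrite /frame pad_pad det1 oner_neq0.
Qed.

(** Normalization fixes the tuples that begin with the three coordinate points,
    so the witness of a condition on normalized tuples may be any of these. *)
Lemma generic_normalize n (phi : 'M[R]_(3, n) -> 'M[R]_(3, n) -> R) X0 Y0 :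
  frame X0 = 1%:M -> frame Y0 = 1%:M -> polyfun phi -> phi X0 Y0 != 0 ->
  for_generic_tuples (fun X Y => phi (normalize X) (normalize Y) != 0 /\
                                 phi (normalize Y) (normalize X) != 0).
Proof.
move=> fX fY pphi phi0.
have nE (Z : 'M[R]_(3, n)) : frame Z = 1%:M -> normalize Z = Z.
  by move=> fZ; rewrite /normalize /to_frame fZ -[\adj _]mulmx1 mul_adj_mx det1 mul1mx.
apply: (@generic_polyfun_swap _ _ (fun X Y => phi (normalize X) (normalize Y)) X0 Y0).
  apply: polyfun_comp => //; apply: polymxM;
    try (exact: polymx_fst); try (exact: polymx_snd).
    by apply/polymx_adj/polymx_pad/polymx_fst.
  by apply/polymx_adj/polymx_pad/polymx_snd.
by rewrite !nE.
Qed.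

(** Once the first three pairs are the coordinate points, an epipolar form has
    zero diagonal; [epi_mx a g] are the zero-diagonal forms with left kernel
    [a], see [zero_diag_epi_mx], and the unknown is the vector [g]. *)
Definition epi_mx a g : 'M[R]_3 := cross_mx a *m diag_mx g^T.

Lemma mul_epi_mx a g v : epi_mx a g *m v = cross a (hadamard g v).
Proof.
rewrite -mulmxA mul_cross_mx; congr (cross a _); apply/matrixP => i j.
by rewrite (ord1 j) mul_diag_mx !mxE.
Qed.

(** A pair [x], [y] imposes on [epi_mx a g] a single linear equation in [g],
    and this is its vector of coefficients. *)
Definition residual a x y : 'cV[R]_3 := hadamard y (cross a x).

Lemma bil_epi_mx a g x y : bil (epi_mx a g) x y = - dot (residual a x y) g.
Proof.
rewrite /bil -mulmxA mul_epi_mx mxE sum3 dotE !mxE /= ?mxE /=; ring.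
Qed.

Lemma epi_mx_left a g : (epi_mx a g)^T *m a = 0.
Proof.
apply: col3P; do 4![rewrite ?(mxE, sum3) /=]; ring.
Qed.

(** Column [k] is orthogonal both to [a] and to the [k]-th coordinate vector,
    hence a multiple of their cross product. *)
Lemma zero_diag_epi_mx a F : (forall k, F k k = 0) -> F^T *m a = 0 ->
  (forall k, ~ proj_eq (delta_mx k 0) a) -> a != 0 ->
  exists g, F = epi_mx a g.
Proof.
move=> F0 Fa an a0.
have colF k : exists c, col k F = c *: cross a (delta_mx k 0).
  apply: perp_cross.
  - apply/eqP => /cross_eq0; case=> [|c aE].
      by apply: (@col_neq0 _ _ _ k); rewrite mxE !eqxx oner_neq0.
    by apply: (an k); apply: proj_eq_sym; exact: proj_eq_scale a0 aE.
  - have /matrixP/(_ k 0) := Fa; rewrite !mxE => <-.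
    by rewrite /dot; apply: eq_bigr => i _; rewrite !mxE.
  - rewrite /dot (bigD1 k) //= big1; first by rewrite !mxE F0 mul0r addr0.
    by move=> i ik; rewrite !mxE (negbTE ik) mulr0.
have [g gE] := boolp.choice colF.
exists (\col_k g k); apply/matrixP => i j.
have /matrixP/(_ i 0) := gE j; rewrite mxE => ->.
by rewrite /epi_mx mul_mx_diag !mxE mulrC.
Qed.

Lemma rank_ge2 F b : (forall v, F *m v = 0 -> exists c, v = c *: b) -> (1 < \rank F)%N.
Proof.
move=> kerF.
have : (kermx F^T <= b^T)%MS.
  apply/rV_subP => v /sub_kermxP vF.
  have [|c vE] := kerF v^T; first by rewrite -[F]trmxK -trmx_mul vF trmx0.
  by apply/sub_rVP; exists c; rewrite -[v]trmxK vE linearZ.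
move=> /mxrankS; rewrite mxrank_ker mxrank_tr => le.
have := leq_trans le (rank_leq_row _); rewrite leq_subLR addn1 ltnS.
by case: (\rank F) => [|[|]].
Qed.

Lemma epi_mx_rank2 a g : a != 0 -> (forall k, g k 0 != 0) -> \rank (epi_mx a g) = 2%N.
Proof.
move=> a0 g0; apply/eqP; rewrite eqn_leq; apply/andP; split.
  rewrite leqNgt; apply/negP => r3.
  have : epi_mx a g \in unitmx.
    by rewrite -row_free_unit /row_free eqn_leq r3 rank_leq_row.
  by rewrite unitmxE (row_det0 a0) ?unitr0 // -[epi_mx a g]trmxK -trmx_mul epi_mx_left trmx0.
apply: (@rank_ge2 _ (\col_k (a k 0 / g k 0))) => v.
rewrite mul_epi_mx => cr0.
have [|c hE] := @cross_eq0 _ (hadamard g v) a _ a0.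
  apply: col3P; have /matrixP h := cr0; move: (h o0 0) (h o1 0) (h o2 0);
  rewrite !mxE /= ?mxE; lra.
exists c; apply/matrixP => k j; rewrite (ord1 j) !mxE.
apply: (mulfI (g0 k)); have /matrixP/(_ k 0) := hE; rewrite !mxE => ->.
by rewrite mulrCA [g k 0 * _]mulrC divfK.
Qed.

Lemma bil_delta F (k l : 'I_3) (c d : R) :
  bil F (c *: delta_mx k 0) (d *: delta_mx l 0) = c * d * F k l.
Proof.
rewrite /bil -scalemxAr [(c *: _)^T]linearZ /= -!scalemxAl trmx_delta -mulmxA -colE -rowE !mxE.
by rewrite mulrCA mulrA.
Qed.

Lemma normalized_epipolar n (X Y : 'M[R]_(3, n)) F : (2 < n)%N ->
  normalized X -> normalized Y -> epipolar X Y F -> forall k, F k k = 0.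
Proof.
move=> n3 nX nY ep k; pose i := widen_ord n3 k.
have [c c0 xE] := nX i k erefl; have [d d0 yE] := nY i k erefl.
have := ep i; rewrite xE yE bil_delta => /eqP.
by rewrite !mulf_eq0 (negbTE c0) (negbTE d0) => /eqP.
Qed.

Lemma epi_mx_epipolar n (X Y : 'M[R]_(3, n)) a g :
  normalized X -> normalized Y ->
  (forall j : 'I_n, (2 < j)%N -> dot (residual a (col j X) (col j Y)) g = 0) ->
  epipolar X Y (epi_mx a g).
Proof.
move=> nX nY res j; have [j3|j3] := ltnP 2 j; first by rewrite bil_epi_mx res ?oppr0.
have [c _ ->] := nX j (Ordinal (j3 : (j < 3)%N)) erefl.
have [d _ ->] := nY j (Ordinal (j3 : (j < 3)%N)) erefl.
rewrite bil_delta; set k := Ordinal _.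
suff -> : epi_mx a g k k = 0 by rewrite mulr0.
rewrite /epi_mx mul_mx_diag mxE.
suff -> : cross_mx a k k = 0 by rewrite mul0r.
by elim/ord3_ind: k; do 3![rewrite ?mxE /=]; ring.
Qed.

Lemma not_coord a k l : k != l -> a l 0 != 0 -> ~ proj_eq (delta_mx k 0) a.
Proof.
move=> kl al [c c0 /matrixP/(_ l 0)]; rewrite !mxE eq_sym (negbTE kl) /=.
by move/esym/eqP; rewrite mulf_eq0 (negbTE c0) (negbTE al).
Qed.

Lemma nonzero_coords a : (forall k, a k 0 != 0) ->
  a != 0 /\ forall k, ~ proj_eq (delta_mx k 0) a.
Proof.
move=> ak; split; first exact: col_neq0 (ak o0).
elim/ord3_ind; [apply: (@not_coord _ _ o1)|apply: (@not_coord _ _ o0)|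
  apply: (@not_coord _ _ o0)]; by rewrite ?ak.
Qed.

Lemma normalized_not_proj n (X : 'M[R]_(3, n)) a (j : 'I_n) : normalized X ->
  (forall k, a k 0 != 0) -> (j < 3)%N -> ~ proj_eq (col j X) a.
Proof.
move=> nX ak j3; have [c c0 ->] := nX j (Ordinal j3) erefl.
case=> d d0 e; have [_ /(_ (Ordinal j3))] := nonzero_coords ak; apply.
exists (c^-1 * d); first by rewrite mulf_neq0 ?invr_eq0.
by rewrite -scalerA -e scalerA mulVf // scale1r.
Qed.

Definition quotient a b : 'cV[R]_3 := \col_k (a k 0 / b k 0).

(** The right kernel [b] of [epi_mx a g] is given by [g_k b_k = a_k] up to
    scale, so prescribing [a] and [b] amounts to taking [g = quotient a b]. *)
Lemma locus_if n (X Y : 'M[R]_(3, n)) a b :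
  point_tuple X -> point_tuple Y -> normalized X -> normalized Y ->
  (forall k, a k 0 != 0) -> (forall k, b k 0 != 0) ->
  (forall j : 'I_n, (2 < j)%N ->
     [/\ dot (residual a (col j X) (col j Y)) (quotient a b) = 0,
         ~ proj_eq (col j X) a & ~ proj_eq (col j Y) b]) ->
  center_locus X Y a b.
Proof.
move=> pX pY nX nY ak bk res; apply/center_locusP => //.
have [a0 _] := nonzero_coords ak; have [b0 _] := nonzero_coords bk.
split=> //.
- move=> j; have [j3|j3] := ltnP 2 j; first by have [] := res j j3.
  exact: normalized_not_proj.
- move=> j; have [j3|j3] := ltnP 2 j; first by have [] := res j j3.
  exact: normalized_not_proj.
exists (epi_mx a (quotient a b)); split.
- by apply: epi_mx_rank2 => // k; rewrite mxE mulf_neq0 ?invr_eq0.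
- exact: epi_mx_left.
- rewrite mul_epi_mx (_ : hadamard _ _ = 1 *: a).
    by apply: col3P; rewrite !mxE /= ?mxE; ring.
  by apply/matrixP => k j; rewrite (ord1 j) !mxE divfK // mul1r.
- by apply: epi_mx_epipolar => // j /res[].
Qed.

(** A zero entry of [g] would put a coordinate point, which is one of the
    [y_i], in the right kernel; hence [g] and [b] have no zero entry. *)
Lemma locus_only_if n (X Y : 'M[R]_(3, n)) a b : (2 < n)%N ->
  point_tuple X -> point_tuple Y -> normalized X -> normalized Y ->
  (forall k, a k 0 != 0) -> center_locus X Y a b ->
  (forall k, b k 0 != 0) /\
  (forall j, dot (residual a (col j X) (col j Y)) (quotient a b) = 0).
Proof.
move=> n3 pX pY nX nY ak /center_locusP-/(_ pX pY)[a0 b0 _ yb [F [rF Fa Fb ep]]].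
have [_ an] := nonzero_coords ak.
have [g FE] := zero_diag_epi_mx (normalized_epipolar n3 nX nY ep) Fa an a0.
have gk k : g k 0 != 0.
  apply/eqP => gk0; have [d d0 yE] := nY (widen_ord n3 k) k erefl.
  apply: (yb (widen_ord n3 k)); rewrite yE; apply: (@proj_eq_trans _ _ _ (delta_mx k 0)).
    by exists d.
  apply: (ker_proj_eq rF) => //; last first.
    by apply: (@col_neq0 _ _ _ k); rewrite mxE !eqxx oner_neq0.
  rewrite FE mul_epi_mx; suff -> : hadamard g (delta_mx k 0) = 0 *: a.
    by apply: col3P; rewrite !mxE /= ?mxE; ring.
  apply/matrixP => l j; rewrite (ord1 j) !mxE mul0r.
  by have [->|lk] := eqVneq l k; rewrite ?gk0 ?mul0r // mulr0.
have [c hE] : exists c, hadamard g b = c *: a.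
  apply: cross_eq0 => //; apply: col3P; move: Fb; rewrite FE mul_epi_mx => /matrixP h;
  move: (h o0 0) (h o1 0) (h o2 0); rewrite !mxE /= ?mxE; lra.
have bE k : b k 0 = c * (a k 0 / g k 0).
  have /matrixP/(_ k 0) := hE; rewrite !mxE => h; apply: (mulfI (gk k)).
  by rewrite h mulrCA [g k 0 * _]mulrC divfK.
have c0 : c != 0.
  apply: contra_neq b0 => c0; apply/matrixP => k j.
  by rewrite (ord1 j) bE c0 mul0r mxE.
split=> [k|j]; first by rewrite bE !mulf_neq0 ?invr_eq0.
have : dot (residual a (col j X) (col j Y)) g = 0.
  by have := ep j; rewrite FE bil_epi_mx => /eqP; rewrite oppr_eq0 => /eqP.
suff -> : quotient a b = c^-1 *: g.
  rewrite !dotE !mxE => h; transitivity (c^-1 * 0); last exact: mulr0.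
  by rewrite -h; ring.
apply/matrixP => k l; rewrite (ord1 l) !mxE bE.
rewrite !invfM invrK mulrCA; congr (_ * _).
by rewrite mulrA mulfV ?mul1r.
Qed.
End Coordinates.

(** * Three, four and five points, and the cubic of six points *)

Section FewPoints.
Variable R : realType.
Implicit Types (a b g x y u v w : 'cV[R]_3) (F N M : 'M[R]_3).

Lemma polymx_residual n a (x y : 'M[R]_(3, n) -> 'M[R]_(3, n) -> 'cV[R]_3) :
  polymx x -> polymx y -> polymx (fun X Y => residual a (x X Y) (y X Y)).
Proof.
by move=> px py; apply: polymx_hadamard => //; apply: polymx_cross => //; exact: polymx_cst.
Qed.

Lemma hvec_residual x y : hvec 1 (fun a => residual a x y).
Proof.
exact: hvec_hadamard (hvec_cst y) (hvec_cross (@hvec_id R) (hvec_cst x)).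
Qed.

Lemma prod_neq0 (u : 'cV[R]_3) : \prod_k u k 0 != 0 <-> forall k, u k 0 != 0.
Proof.
split=> [/prodf_neq0 h k|h]; first exact: h.
by apply/prodf_neq0 => k _.
Qed.

Lemma residual_not_proj a x y : residual a x y != 0 -> ~ proj_eq x a.
Proof.
move=> /eqP r0 [c _ xE]; apply: r0; rewrite xE.
by apply: col3P; do 3![rewrite ?mxE /=]; ring.
Qed.

(** Three pairs only make the diagonal vanish, which [epi_mx a (quotient a b)]
    does for all [a] and [b] off the coordinate lines. *)
Lemma locus_le3 n (X Y : 'M[R]_(3, n)) : (n < 4)%N ->
  point_tuple X -> point_tuple Y -> \det (frame X) != 0 -> \det (frame Y) != 0 ->
  exists (d e : nat) (f g : {mpoly R[3]}),
    [/\ plane_form d f, plane_form e g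
      & forall a b, a != 0 -> b != 0 -> ~ on_curve f a -> ~ on_curve g b ->
        center_locus X Y a b].
Proof.
move=> n4 pX pY dX dY.
have uX := to_frame_unit dX; have uY := to_frame_unit dY.
have [d [f [pf fP]]] := generic_point_subst uX (generic_point_coords R).
have [e [g [pg gP]]] := generic_point_subst uY (generic_point_coords R).
exists d, e, f, g; split=> // a b a0 b0 fa gb; rewrite locus_normalize //.
apply: locus_if; try exact: normalize_normalized; try exact: point_tuple_normalize.
- exact: fP.
- exact: gP.
by move=> j j3; have := leq_trans (ltn_ord j) n4; rewrite ltnS leqNgt j3.
Qed.

Section FourPoints.
Variables (X Y : 'M[R]_(3, 4)) (a : 'cV[R]_3).
Let j3 := @Ordinal 4 3 isT.
Let w := residual a (col j3 X) (col j3 Y).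
Hypotheses (pX : point_tuple X) (pY : point_tuple Y).
Hypotheses (nX : normalized X) (nY : normalized Y).
Hypotheses (ak : forall k, a k 0 != 0) (wk : forall k, w k 0 != 0).

Let c k := w k 0 * a k 0.
Let q b := c o0 * (b o1 0 * b o2 0) + c o1 * (b o2 0 * b o0 0) + c o2 * (b o0 0 * b o1 0).

Let ck k : c k != 0.
Proof. by rewrite mulf_neq0. Qed.

Let hform_q : hform 2 q.
Proof.
have h i j k : hform 2 (fun b => c i * (b j 0 * b k 0)).
  by apply: hformZ; apply: (@hformM _ 1 1); exact: hform_coord.
by do 2?apply: hformD.
Qed.

Let qE b : (forall k, b k 0 != 0) ->
  q b = b o0 0 * b o1 0 * b o2 0 * dot w (quotient a b).
Proof.
move=> bk; rewrite dotE ![quotient a b _ _]mxE /q /c.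
have := bk o0; have := bk o1; have := bk o2; move=> h2 h1 h0; field.
by rewrite h0 h1 h2.
Qed.

(** The fourth pair gives the equation [dot w (quotient a b) = 0] in [b]; the
    conic [q] is obtained by clearing denominators.  It meets the coordinate
    lines only at the coordinate points. *)
Lemma four_points_conic : fills_conic (center_locus X Y a).
Proof.
have [f pf fE] : exists2 f : {mpoly R[3]}, plane_form 2 f
    & forall b, f.@[fun k => b k 0] = q b.
  apply: (plane_formP (a0 := vec3 0 1 1) hform_q).
  by rewrite /q !mxE /= !(mul0r, mulr0, mulr1, addr0).
exists f; split=> //.
- move=> b Lb; have [b0] : b != 0 /\ center_locus X Y a b.
    by split=> //; case: Lb => A [B [_ _ _ []]].
  case/(locus_only_if (n := 4) isT pX pY nX nY ak) => bk /(_ j3) res.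
  by split=> //; rewrite fE qE // res mulr0.
split.
- move=> s.
  pose p := ((c o1)%:P + c o0 *: 'X) *
    \prod_(v <- s | v o0 0 != 0) ((v o1 0)%:P - v o0 0 *: 'X) : {poly R}.
  have lin0 (r t : R) : t != 0 -> r%:P + t *: 'X != 0 :> {poly R}.
    move=> t0; apply: contra_neq t0 => /(congr1 (fun p : {poly R} => p`_1)).
    by rewrite coefD coefC coefZ coefX coef0 /= add0r mulr1.
  have [t] : exists t, p.[t] != 0.
    apply: nonroot; rewrite mulf_neq0 ?lin0 //.
    rewrite prodf_seq_neq0; apply/allP => v _; apply/implyP => v0.
    by rewrite -scaleNr lin0 ?oppr_eq0.
  rewrite hornerM mulf_eq0 negb_or !(hornerD, hornerC, hornerZ, hornerX).
  set D := (_ + _) => /andP[D0]; rewrite horner_prod prodf_seq_neq0 => /allP ts.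
  (* The point of the conic with second coordinate [t] times the first; [D] is
     the denominator of its third coordinate. *)
  exists (vec3 D (t * D) (- (c o2 * t))).
    split; first by apply: (@col_neq0 _ _ _ o0); rewrite mxE.
    rewrite fE /q !mxE /= /D; ring.
  move=> v vs [k k0 /matrixP vE].
  have D0E : D = k * v o0 0 by have := vE o0 0; rewrite !mxE.
  have D1E : t * D = k * v o1 0 by have := vE o1 0; rewrite !mxE.
  have v0 : v o0 0 != 0 by apply: contra_neq D0 => v0; rewrite D0E v0 mulr0.
  have := ts v vs; rewrite v0 /= !(hornerD, hornerN, hornerC, hornerZ, hornerX).
  move/eqP; apply; apply: (mulfI k0).
  by rewrite mulr0 mulrBr -D1E mulrA -D0E; ring.
exists [:: delta_mx o0 0; delta_mx o1 0; delta_mx o2 0; col j3 Y] => b [b0].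
rewrite fE => qb av.
have notdelta k : ~ proj_eq b (delta_mx k 0).
  by apply: av; elim/ord3_ind: k; rewrite !inE eqxx ?orbT.
have two0 i j k : (forall l, l \in [:: i; j; k]) -> b i 0 = 0 -> b j 0 = 0 -> False.
  move=> all bi bj; apply: (notdelta k); apply: (@proj_eq_scale _ _ _ _ (b k 0)) => //.
  apply/matrixP => l m; rewrite (ord1 m) !mxE eqxx andbT.
  have [->|lk] := eqVneq l k; first by rewrite mulr1.
  rewrite mulr0; have := all l; rewrite !inE (negbTE lk) orbF.
  by case/orP=> /eqP->.
have cut k r t : c k * (r * t) = 0 -> r = 0 \/ t = 0.
  move/eqP; rewrite mulf_eq0 (negbTE (ck k)) /= mulf_eq0.
  by case/orP=> /eqP; [left | right].
have bk : forall k, b k 0 != 0.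
  move: qb; rewrite /q => qb0; elim/ord3_ind; apply/eqP => bk0; move: qb0;
  rewrite bk0 !(mul0r, mulr0, addr0, add0r) => /cut[] b1.
  - by apply: (two0 o0 o1 o2) b1; first by elim/ord3_ind.
  - by apply: (two0 o0 o2 o1) b1; first by elim/ord3_ind.
  - by apply: (two0 o1 o2 o0) b1; first by elim/ord3_ind.
  - by apply: (two0 o1 o0 o2) b1; first by elim/ord3_ind.
  - by apply: (two0 o2 o0 o1) b1; first by elim/ord3_ind.
  - by apply: (two0 o2 o1 o0) b1; first by elim/ord3_ind.
apply: locus_if => // j j3j.
have -> : j = j3.
  by apply: val_inj; apply/anti_leq; rewrite /= -ltnS ltn_ord j3j.
split.
- apply/eqP; move/eqP: qb; rewrite qE // !mulf_eq0.
  by rewrite !(negbTE (bk _)).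
- by apply: (@residual_not_proj _ _ (col j3 Y)); exact: col_neq0 (wk o0).
- by move=> /proj_eq_sym; apply: av; rewrite !inE eqxx !orbT.
Qed.
End FourPoints.

Lemma generic_residual x y : (forall k, x k 0 != 0) -> (forall k, y k 0 != 0) ->
  for_generic_point (fun a => forall k, residual a x y k 0 != 0).
Proof.
move=> xk yk; have h k a0 := @generic_point_hform _ _ _ a0 (hvec_residual x y k).
have g0 := h o0 (delta_mx o1 0); have g1 := h o1 (delta_mx o2 0).
have g2 := h o2 (delta_mx o0 0).
have := generic_point_and (g0 _) (generic_point_and (g1 _) (g2 _)).
move=> gen; apply: (generic_point_mono _ (gen _ _ _)).
- by move=> a _ [? [? ?]]; elim/ord3_ind.
- by do 3![rewrite ?mxE /=]; rewrite mul1r mul0r subr0 mulf_neq0.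
- by do 3![rewrite ?mxE /=]; rewrite mul1r mul0r subr0 mulf_neq0.
- by do 3![rewrite ?mxE /=]; rewrite mul1r mul0r subr0 mulf_neq0.
Qed.

Lemma four_points (X Y : 'M[R]_(3, 4)) (j3 := @Ordinal 4 3 isT) :
  point_tuple X -> point_tuple Y -> normalized X -> normalized Y ->
  (forall k, X k j3 != 0) -> (forall k, Y k j3 != 0) ->
  for_generic_point (fun a => fills_conic (center_locus X Y a)).
Proof.
move=> pX pY nX nY xk yk.
have := @generic_residual (col j3 X) (col j3 Y).
move=> gen; apply: generic_point_mono (generic_point_and (generic_point_coords R) (gen _ _)).
- by move=> a _ [ak wk]; exact: four_points_conic.
- by move=> k; rewrite mxE.
- by move=> k; rewrite mxE.
Qed.

Section FivePoints.
Let j3 := @Ordinal 5 3 isT.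
Let j4 := @Ordinal 5 4 isT.
Implicit Types X Y : 'M[R]_(3, 5).

(** Spans the solutions [g] of the two equations given by the fourth and fifth
    pairs, when these are independent. *)
Definition five_g a X Y : 'cV[R]_3 :=
  cross (residual a (col j3 X) (col j3 Y)) (residual a (col j4 X) (col j4 Y)).

(** Vanishes when the center [quotient a g] is the point [y_j], since then
    [hadamard g y_j] is proportional to [a]. *)
Definition five_miss a X Y j := cross a (hadamard (five_g a X Y) (col j Y)).

Definition five_cond a X Y : R :=
  (\prod_k five_g a X Y k 0) * (five_miss a X Y j3 o0 0 * five_miss a X Y j4 o0 0).

Lemma polyfun_five_cond a : polyfun (five_cond a).
Proof.
have pg : polymx (five_g a).
  apply: polymx_cross; apply: polymx_residual; apply: polymx_col;
    by [exact: polymx_fst | exact: polymx_snd].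
have pm j : polymx (fun X Y => five_miss a X Y j).
  apply: polymx_cross; first exact: polymx_cst.
  by apply: polymx_hadamard => //; apply: polymx_col; exact: polymx_snd.
by apply: polyfunM; [exact: polyfun_prod3 | apply: polyfunM; apply: pm].
Qed.

(** The two equations have independent coefficients at a generic [a], so [g] and
    with it [b = quotient a g] are determined.  The conditions are forms in
    [a]: it is enough that they do not vanish at one point [a0]. *)
Lemma five_points X Y a0 :
  point_tuple X -> point_tuple Y -> normalized X -> normalized Y ->
  five_cond a0 X Y != 0 -> for_generic_point (fun a => unique_point (center_locus X Y a)).
Proof.
move=> pX pY nX nY; rewrite /five_cond !mulf_eq0 !negb_or.
case/andP=> /prod_neq0 g0 /andP[m3 m4].
have hg : hvec 2 (fun a => five_g a X Y).
  by apply: (@hvec_cross _ 1 1); exact: hvec_residual.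
have hm j : hvec 3 (fun a => five_miss a X Y j).
  by apply: (@hvec_cross _ 1 2 id) (@hvec_id R) _; apply: (@hvec_hadamard _ 2 0) hg (hvec_cst _).
have gen := generic_point_and (generic_point_hform (hm j3 o0) m3)
              (generic_point_hform (hm j4 o0) m4).
have := generic_point_and (generic_point_coords R)
  (generic_point_and (generic_point_hvec hg g0) gen).
apply: generic_point_mono => a _ [ak [gk [/col_neq0 ma3 /col_neq0 ma4]]].
rewrite /five_miss in ma3 ma4; move: gk ma3 ma4; rewrite /five_g.
set w3 := residual a (col j3 X) _; set w4 := residual a (col j4 X) _.
have [r3 r4] : (w3 = 0 -> cross w3 w4 = 0) /\ (w4 = 0 -> cross w3 w4 = 0).
  by split=> ->; apply: col3P; do 3![rewrite ?mxE /=]; ring.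
have dotg3 := dot_cross1 w3 w4; have dotg4 := dot_cross2 w3 w4.
have perp := @perp_cross _ w3 w4.
move: (cross w3 w4) r3 r4 dotg3 dotg4 perp => g r3 r4 dotg3 dotg4 perp gk ma3 ma4.
have gN0 : g != 0 := col_neq0 (gk o0).
have bk k : (quotient a g) k 0 != 0 by rewrite mxE mulf_neq0 ?invr_eq0.
have qg : quotient a (quotient a g) = g.
  by apply/matrixP => k l; rewrite (ord1 l) !mxE invf_div mulrCA divff ?mulr1.
have miss j : cross a (hadamard g (col j Y)) != 0 -> ~ proj_eq (col j Y) (quotient a g).
  move=> /eqP m [c c0 yE]; apply: m; rewrite yE.
  have -> : hadamard g (c *: quotient a g) = c *: a.
    apply/matrixP => k l; rewrite (ord1 l) !mxE mulrCA; congr (_ * _).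
    by rewrite mulrCA divff ?mulr1.
  by apply: col3P; do 3![rewrite ?mxE /=]; ring.
exists (quotient a g).
  apply: locus_if => // -[[|[|[|[|[|m]]]]] Hj] // _; rewrite qg.
    rewrite (_ : Ordinal Hj = j3); last exact: val_inj.
    by split=> //; [|exact: miss];
      apply: (@residual_not_proj _ _ (col j3 Y)); exact: contra_neq r3 gN0.
  rewrite (_ : Ordinal Hj = j4); last exact: val_inj.
  by split=> //; [|exact: miss];
      apply: (@residual_not_proj _ _ (col j4 Y)); exact: contra_neq r4 gN0.
move=> b' /(locus_only_if (n := 5) isT pX pY nX nY ak)[b'k res].
have [c qE] : exists c, quotient a b' = c *: g.
  by apply: perp => //; rewrite dotC; exact: res.
have qk k : quotient a b' k 0 != 0 by rewrite mxE mulf_neq0 ?invr_eq0.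
have c0 : c != 0.
  by have := qk o0; apply: contra_neq => c0; rewrite qE c0 scale0r mxE.
exists c^-1; first by rewrite invr_eq0.
apply/matrixP => k l; rewrite (ord1 l) !mxE.
have := congr1 (fun v : 'cV_3 => v k 0) qE; rewrite !mxE => h.
by rewrite mulrCA -invfM -h invf_div mulrCA divff ?mulr1.
Qed.
End FivePoints.

Section CubicOfNet.
Let j3 := @Ordinal 6 3 isT.
Let j4 := @Ordinal 6 4 isT.
Let j5 := @Ordinal 6 5 isT.
Implicit Types X Y : 'M[R]_(3, 6).

Definition mx3 u v w : 'M[R]_3 := \matrix_(i, j) (vec3 (u j 0) (v j 0) (w j 0)) i 0.

Definition six_mx a X Y : 'M[R]_3 :=
  mx3 (residual a (col j3 X) (col j3 Y)) (residual a (col j4 X) (col j4 Y))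
      (residual a (col j5 X) (col j5 Y)).

(** Up to the factor [y_0 y_1 y_2], the vector of ratios [x_k / y_k]. *)
Definition weight x y : 'cV[R]_3 :=
  hadamard x (vec3 (y o1 0 * y o2 0) (y o2 0 * y o0 0) (y o0 0 * y o1 0)).

Definition six_cond a X Y : R :=
  \det (six_mx a X Y) *
  (\det (mx3 (weight (col j3 X) (col j3 Y)) (weight (col j4 X) (col j4 Y))
            (weight (col j5 X) (col j5 Y))) *
   ((\prod_k Y k j3) * ((\prod_k Y k j4) * \prod_k Y k j5))).

Lemma mul_mx3 u v w g : mx3 u v w *m g = vec3 (dot u g) (dot v g) (dot w g).
Proof. by apply: col3P; rewrite !mxE /= dotE sum3 !mxE /=. Qed.

Lemma polymx_mx3 n (u v w : 'M[R]_(3, n) -> 'M[R]_(3, n) -> 'cV[R]_3) :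
  polymx u -> polymx v -> polymx w ->
  polymx (fun X Y : 'M[R]_(3, n) => mx3 (u X Y) (v X Y) (w X Y)).
Proof.
move=> pu pv pw i j; have p := polymx_vec3 (pu j 0) (pv j 0) (pw j 0).
by apply: polyfun_ext (p i 0) => X Y; rewrite [RHS]mxE.
Qed.

Lemma polyfun_six_cond a : polyfun (six_cond a).
Proof.
have px j : polymx (fun X Y => col j X) by apply: polymx_col; exact: polymx_fst.
have py j : polymx (fun X Y => col j Y) by apply: polymx_col; exact: polymx_snd.
have pw j : polymx (fun X Y => weight (col j X) (col j Y)).
  by apply: polymx_hadamard => //; apply: polymx_vec3; apply: polyfunM; exact: py.
apply: polyfunM; last apply: polyfunM.
- by apply/polyfun_det/polymx_mx3; exact: polymx_residual.
- exact/polyfun_det/polymx_mx3.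
- by do 2?apply: polyfunM; apply: polyfun_prod => k; exact: polymx_snd.
Qed.

Lemma hform_det_six X Y : hform 3 (fun a => \det (six_mx a X Y)).
Proof.
have h i j : hform 1 (fun a => six_mx a X Y i j).
  have r k := hvec_residual (col k X) (col k Y) j.
  elim/ord3_ind: i; [apply: hform_ext (r j3)|apply: hform_ext (r j4)|
    apply: hform_ext (r j5)] => a; by rewrite [in RHS]mxE [in RHS]mxE.
apply: (hform_ext (fun a => esym (det3 (six_mx a X Y)))).
by apply: hformD; [apply: hformB|]; apply: (@hformM _ 1 2) => //;
  apply: hformB; apply: (@hformM _ 1 1).
Qed.

Definition left_net n (X Y : 'M[R]_(3, n)) a F := epipolar X Y F /\ F^T *m a = 0.

(** The points [x_i] are left out: when [a = x_i], one of the constraints follows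
    from [F^T a = 0], so that the form need not be determined by [a]. *)
Definition net_cubic n (X Y : 'M[R]_(3, n)) (f : {mpoly R[3]}) :=
  forall a, a != 0 -> (forall i, ~ proj_eq (col i X) a) ->
  (f.@[fun k => a k 0] = 0 <-> exists2 F, F != 0 & left_net X Y a F) /\
  (forall F G, left_net X Y a F -> left_net X Y a G -> F != 0 -> exists c, G = c *: F).

Lemma epi_mxZ a c g : epi_mx a (c *: g) = c *: epi_mx a g.
Proof.
apply/matrixP => i j; rewrite !mxE !sum3 !mxE; ring.
Qed.

(** The last three pairs give three linear equations in [g], whose determinant
    is a cubic form in [a].  The last conclusion says that these equations have
    rank 2 on the curve, and this is what the condition on the weights is for. *)
Lemma six_points_cubic X Y a0 : normalized X -> normalized Y -> point_tuple X ->
  six_cond a0 X Y != 0 -> exists2 f, plane_form 3 f & net_cubic X Y f.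
Proof.
move=> nX nY pX; rewrite /six_cond !mulf_eq0 !negb_or.
case/and3P=> /(plane_formP (hform_det_six X Y))[f pf fE] dw /and3P[y3 y4 y5].
exists f => // a an0 ax; rewrite fE.
have ae k : ~ proj_eq (delta_mx k 0) a.
  pose i := widen_ord (isT : (3 <= 6)%N) k; have [c c0 xE] := nX i k erefl.
  move=> h; apply: (ax i); rewrite xE; apply: proj_eq_trans h; by exists c.
have leftP F : left_net X Y a F <->
    exists2 g, F = epi_mx a g & six_mx a X Y *m g = 0.
  split=> [[ep Fa]|[g -> kg]].
    have [g FE] := zero_diag_epi_mx (normalized_epipolar (n := 6) isT nX nY ep) Fa ae an0.
    exists g => //; have res j : dot (residual a (col j X) (col j Y)) g = 0.
      by have := ep j; rewrite FE bil_epi_mx => /eqP; rewrite oppr_eq0 => /eqP.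
    by rewrite mul_mx3 !res; apply: col3P; rewrite !mxE.
  split; last exact: epi_mx_left.
  have /matrixP h := kg; move: (h o0 0) (h o1 0) (h o2 0).
  rewrite mul_mx3 !mxE /= => h3 h4 h5; apply: epi_mx_epipolar => // j jgt.
  suff /or3P[/eqP->|/eqP->|/eqP->] : [|| j == j3, j == j4 | j == j5] by [].
  by case: j jgt => [[|[|[|[|[|[|m]]]]]] Hj].
have epi0 g : epi_mx a g = 0 -> g = 0.
  move=> /matrixP e0; apply/matrixP => k l; rewrite (ord1 l) [RHS]mxE.
  apply: contra_not_eq (ae k) => gk.
  apply: proj_eq_sym; have [||c aE] := @cross_eq0 _ a (delta_mx k 0).
  - apply/matrixP => i j; rewrite (ord1 j) [RHS]mxE; apply: (mulfI gk); rewrite mulr0.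
    by have := e0 i k; rewrite /epi_mx mul_mx_diag !mxE mulrC.
  - by apply: (@col_neq0 _ _ _ k); rewrite mxE !eqxx oner_neq0.
  - exact: proj_eq_scale aE.
split.
  split=> [/det0_col[g g0 kg]|[F F0 /leftP[g FE kg]]].
    exists (epi_mx a g); first by apply: contra_neq g0 => /epi0.
    by apply/leftP; exists g.
  apply: (@col_det0 _ _ _ g) => //; apply: contra_neq F0 => g0.
  by rewrite FE g0; apply/matrixP => i j; rewrite !mxE sum3 !mxE; ring.
move=> F G /leftP[g -> kg] /leftP[h -> kh] Fn0.
have [cr0|cr] := eqVneq (cross g h) 0.
  have g0 : g != 0.
    apply: contra_neq Fn0 => ->.
    by apply/matrixP => i j; rewrite !mxE sum3 !mxE; ring.
  have [|c ->] := @cross_eq0 _ h g _ g0.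
    move/matrixP: cr0 => h0; apply: col3P; move: (h0 o0 0) (h0 o1 0) (h0 o2 0);
    rewrite !mxE /=; lra.
  by exists c; exact: epi_mxZ.
(* With two independent solutions [g] and [h], the residuals are multiples of
   [cross g h]; as [cross a x_j] is orthogonal to [x_j], dividing out [y_j] shows
   that [cross g h] is orthogonal to the three weights. *)
exfalso; case/negP: dw; apply/eqP; apply: (col_det0 cr).
have kill j : \prod_k Y k j != 0 ->
    dot (residual a (col j X) (col j Y)) g = 0 ->
    dot (residual a (col j X) (col j Y)) h = 0 ->
    dot (weight (col j X) (col j Y)) (cross g h) = 0.
  move=> /prodf_neq0 yj rg rh; have [c rE] := perp_cross cr rg rh.
  have c0 : c != 0.
    apply: contra_not_neq (ax j) => c0; apply: proj_eq_sym.
    have [|d aE] := @cross_eq0 _ a (col j X) _ (pX j).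
      apply/matrixP => k l; rewrite (ord1 l) [RHS]mxE.
      have /eqP := congr1 (fun v : 'cV_3 => v k 0) rE.
      have -> : residual a (col j X) (col j Y) k 0 = Y k j * cross a (col j X) k 0.
        by rewrite [LHS]mxE [col j Y _ _]mxE.
      rewrite c0 scale0r [X in _ == X]mxE mulf_eq0 (negbTE (yj k isT)).
      by move/eqP.
    exact: proj_eq_scale an0 aE.
  apply: (mulfI c0); rewrite mulr0.
  move/matrixP: rE => rE; have := rE o0 0; have := rE o1 0; have := rE o2 0.
  rewrite !dotE; set m := cross g h; rewrite ![(c *: m) _ _]mxE => m2 m1 m0.
  transitivity (weight (col j X) (col j Y) o0 0 * (c * m o0 0) +
    weight (col j X) (col j Y) o1 0 * (c * m o1 0) +
    weight (col j X) (col j Y) o2 0 * (c * m o2 0)); first by ring.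
  by rewrite -m0 -m1 -m2; do 3![rewrite ?mxE /=]; ring.
rewrite mul_mx3; move/matrixP: kg => kg; move/matrixP: kh => kh.
move: (kg o0 0) (kg o1 0) (kg o2 0) (kh o0 0) (kh o1 0) (kh o2 0).
rewrite !mul_mx3 ![vec3 _ _ _ _ _]mxE ![(0 : 'cV_3) _ _]mxE /= => g3 g4 g5 h3 h4 h5.
by rewrite !kill //; apply: col3P; rewrite !mxE.
Qed.
End CubicOfNet.
End FewPoints.

(** * Six points *)

Section Constraints.
Variable R : realType.
Implicit Types (a b g x y u v w : 'cV[R]_3) (F G N M : 'M[R]_3).

(** Column [k] is the linear form [F |-> bil F p_k q_k] in the entries of [F]. *)
Definition constraints m (P Q : 'M[R]_(3, m)) : 'M[R]_(3 * 3, m) :=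
  \matrix_(r, k) mxvec (col k P *m (col k Q)^T) 0 r.

Lemma mul_constraints m (P Q : 'M[R]_(3, m)) F k :
  (mxvec F *m constraints P Q) 0 k = bil F (col k P) (col k Q).
Proof.
have := mxvec_dotmul F (col k P)^T (col k Q)^T; rewrite !trmxK /bil => <-.
by rewrite !mxE; apply: eq_bigr => r _; rewrite !mxE mulrC.
Qed.

Lemma polymx_constraints n m (P Q : 'M[R]_(3, n) -> 'M[R]_(3, n) -> 'M[R]_(3, m)) :
  polymx P -> polymx Q -> polymx (fun X Y => constraints (P X Y) (Q X Y)).
Proof.
move=> pP pQ r k; case/mxvec_indexP: r => i j.
apply: polyfun_ext (polyfunM (pP i k) (pQ j k)) => X Y.
by rewrite !mxE mxvecE !mxE big_ord1 !mxE.
Qed.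

Lemma det_constraints (P Q : 'M[R]_(3, 3 * 3)) :
  \det (constraints P Q) != 0 <->
  (forall F, (forall k, bil F (col k P) (col k Q) = 0) -> F = 0).
Proof.
split=> [dC F FPQ|inj].
  apply: contraNeq dC => F0; apply/det0P; exists (mxvec F).
    by apply: contra_neq F0 => h; rewrite -[F]mxvecK h linear0.
  by apply/rowP => k; rewrite mul_constraints FPQ mxE.
apply/det0P => -[v v0 vC]; case/eqP: v0; rewrite -[v]vec_mxK.
rewrite (inj (vec_mx v)) ?linear0 // => k.
by rewrite -mul_constraints vec_mxK vC mxE.
Qed.

End Constraints.

Section SixPoints.
Variable R : realType.
Implicit Types (a b g x y u v w : 'cV[R]_3) (F G N M : 'M[R]_3).

Definition no_three_collinear n (X : 'M[R]_(3, n)) := forall i j k,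
  [/\ i != j, j != k & k != i] -> \det (mx3 (col i X) (col j X) (col k X)) != 0.

Lemma generic_no_three_collinear n : for_generic_tuples (fun X Y : 'M[R]_(3, n) =>
  no_three_collinear X /\ no_three_collinear Y).
Proof.
suff : for_generic_tuples (fun X Y : 'M[R]_(3, n) =>
    forall t : 'I_n * 'I_n * 'I_n, [/\ t.1.1 != t.1.2, t.1.2 != t.2 & t.2 != t.1.1] ->
    \det (mx3 (col t.1.1 X) (col t.1.2 X) (col t.2 X)) != 0 /\
    \det (mx3 (col t.1.1 Y) (col t.1.2 Y) (col t.2 Y)) != 0).
  by apply: generic_mono => X Y _ _ h; split=> i j k ijk; have [] := h (i, j, k) ijk.
apply: generic_all => -[[i j] k] /=.
have [/and3P[ij jk ki]|dup] := boolP [&& i != j, j != k & k != i]; last first.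
  exists 1; first exact: oner_neq0.
  by move=> X Y _ _ _ /and3P h; rewrite h in dup.
pose X0 : 'M[R]_(3, n) := \matrix_(r, l)
  (if l == i then r == o0 else if l == j then r == o1 else r == o2)%:R.
have pd : polyfun (fun X Y : 'M[R]_(3, n) => \det (mx3 (col i X) (col j X) (col k X))).
  by apply/polyfun_det/polymx_mx3; apply: polymx_col; exact: polymx_fst.
have := @generic_polyfun_swap _ _ _ X0 0 pd.
move=> gen; apply: generic_mono (gen _) => //.
suff -> : mx3 (col i X0) (col j X0) (col k X0) = 1%:M by rewrite det1 oner_neq0.
apply/matrixP => r c; rewrite !mxE !eqxx (eq_sym j i) (negbTE ij) (negbTE ki).
rewrite (eq_sym k j) (negbTE jk).
by elim/ord3_ind: r; elim/ord3_ind: c.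
Qed.

(** For a form [u v^T] each of the six equations puts [x_i] on the line [u] or
    [y_i] on the line [v], so one of the lines contains three of the points. *)
Lemma six_net_not_rank1 (X Y : 'M[R]_(3, 6)) F :
  no_three_collinear X -> no_three_collinear Y -> epipolar X Y F -> \rank F != 1%N.
Proof.
move=> cX cY ep; apply/eqP => /rank_fact[U [V [FE rU rV]]].
have [U0 V0] : U != 0 /\ V^T != 0 by rewrite -!mxrank_eq0 mxrank_tr rU rV.
have line (Z : 'M[R]_(3, 6)) (w : 'cV[R]_3) : no_three_collinear Z -> w != 0 ->
    (2 < #|[set i | (dot (col i Z) w == 0)%R]|)%N -> False.
  move=> cZ w0 /card_gt2P[i [j [k [[]]]]]; rewrite !inE => /eqP zi /eqP zj /eqP zk.
  move=> /cZ /eqP; apply; apply: (col_det0 w0).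
  by rewrite mul_mx3 zi zj zk; apply: col3P; rewrite !mxE.
have or0 i : dot (col i X) U == 0 \/ dot (col i Y) V^T == 0.
  have := ep i; rewrite /bil FE mulmxA -mulmxA mxE big_ord1 => /eqP.
  rewrite mulf_eq0 => /orP[] h; [left|right]; apply: etrans h; congr (_ == _);
  rewrite mxE /dot; apply: eq_bigr => l _; rewrite !mxE //; exact: mulrC.
have := cardsC [set i | (dot (col i X) U == 0)%R]; rewrite card_ord.
set A := [set i | _].
case: (ltnP 2 #|A|) => [/(line _ _ cX U0)//|A2 cA].
apply: (line _ _ cY V0); apply: leq_trans (subset_leq_card (_ : ~: A \subset _)).
  by rewrite -(leq_add2l #|A|) cA -[6%N]/(2 + 4)%N; apply: leq_add.
apply/subsetP => i; rewrite !inE => /negbTE Ai.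
by have [|] := or0 i; rewrite ?Ai.
Qed.

(** The forms satisfying five of the six constraints and killing [y_i] are
    subject to eight linear conditions; the ninth, [F o2 o1 = 0], is an
    arbitrary normalization that makes the system square, so that uniqueness up
    to scale follows from a nonzero determinant. *)
Definition pin_left (X : 'M[R]_(3, 6)) (i : 'I_6) : 'M[R]_(3, 5 + (3 + 1)) :=
  row_mx (\matrix_(r, k) X r (lift i k)) (row_mx 1%:M (delta_mx o2 0)).
Definition pin_right (Y : 'M[R]_(3, 6)) (i : 'I_6) : 'M[R]_(3, 5 + (3 + 1)) :=
  row_mx (\matrix_(r, k) Y r (lift i k)) (row_mx (\matrix_(r, k) Y r i) (delta_mx o1 0)).

Definition pin_cond i (X Y : 'M[R]_(3, 6)) : R :=
  \det (constraints (pin_left X i : 'M[R]_(3, 3 * 3)) (pin_right Y i : 'M[R]_(3, 3 * 3))).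

Lemma pin_condP i (X Y : 'M[R]_(3, 6)) : pin_cond i X Y != 0 <->
  (forall F, (forall k, bil F (col (lift i k) X) (col (lift i k) Y) = 0) ->
     F *m col i Y = 0 -> F o2 o1 = 0 -> F = 0).
Proof.
have colE1 (Z : 'M[R]_(3, 6)) k : col k (\matrix_(r, k) Z r (lift i k)) = col (lift i k) Z.
  by apply/matrixP => r c; rewrite !mxE.
have colE2 (Z : 'M[R]_(3, 6)) (k : 'I_3) :
    col k (\matrix_(r, k) Z r i : 'M[R]_3) = col i Z.
  by apply/matrixP => r c; rewrite !mxE.
have colE3 (k : 'I_3) : col k (1%:M : 'M[R]_3) = 1 *: delta_mx k 0.
  by apply/matrixP => r c; rewrite !mxE (ord1 c) eqxx andbT mul1r.
have colE4 (d : 'I_3) : col 0 (delta_mx d 0 : 'M[R]_(3, 1)) = 1 *: delta_mx d 0.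
  by apply/matrixP => r c; rewrite !mxE (ord1 c) mul1r.
have bilE F k y : bil F (1 *: delta_mx k 0) y = (F *m y) k 0.
  by rewrite scale1r /bil trmx_delta -mulmxA -rowE mxE.
pose iL k : 'I_(3 * 3) := lshift 4 (k : 'I_5).
pose iM k : 'I_(3 * 3) := rshift 5 (lshift 1 (k : 'I_3)).
pose iR : 'I_(3 * 3) := rshift 5 (rshift 3 (0 : 'I_1)).
pose P : 'M_(3, 3 * 3) := pin_left X i; pose Q : 'M_(3, 3 * 3) := pin_right Y i.
have PL k : col (iL k) P = col (lift i k) X := etrans (colKl _ _ _) (colE1 X k).
have QL k : col (iL k) Q = col (lift i k) Y := etrans (colKl _ _ _) (colE1 Y k).
have PM k : col (iM k) P = 1 *: delta_mx k 0.
  exact: etrans (colKr _ _ _) (etrans (colKl _ _ _) (colE3 k)).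
have QM k : col (iM k) Q = col i Y.
  exact: etrans (colKr _ _ _) (etrans (colKl _ _ _) (colE2 Y k)).
have PR : col iR P = 1 *: delta_mx o2 0.
  exact: etrans (colKr _ _ _) (etrans (colKr _ _ _) (colE4 o2)).
have QR : col iR Q = 1 *: delta_mx o1 0.
  exact: etrans (colKr _ _ _) (etrans (colKr _ _ _) (colE4 o1)).
rewrite /pin_cond -/P -/Q; split=> [/det_constraints inj F F5 Fy F21|inj].
  apply: inj => k; case: (@splitP 5 4 k) => [j|j] kE.
    rewrite (_ : k = iL j); last exact: val_inj.
    by rewrite PL QL.
  case: (@splitP 3 1 j) => l jE.
    rewrite (_ : k = iM l); last by apply: val_inj; rewrite /= kE jE.
    by rewrite PM QM bilE Fy mxE.
  rewrite (_ : k = iR); last by apply: val_inj; rewrite /= kE jE (ord1 l).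
  by rewrite PR QR bil_delta F21 mulr0.
apply/det_constraints => F FPQ; apply: inj.
- by move=> k; rewrite -PL -QL.
- by apply/matrixP => k c; rewrite (ord1 c) [RHS]mxE -bilE -PM -(QM k).
- by have := FPQ iR; rewrite PR QR bil_delta !mul1r.
Qed.

Lemma polyfun_pin_cond i : polyfun (pin_cond i).
Proof.
have polymx_row n p q r (A : 'M[R]_(3, n) -> 'M[R]_(3, n) -> 'M[R]_(p, q))
    (B : 'M[R]_(3, n) -> 'M[R]_(3, n) -> 'M[R]_(p, r)) :
    polymx A -> polymx B -> polymx (fun X Y => row_mx (A X Y) (B X Y)).
  move=> pA pB k l; case: (splitP l) => j lE.
    rewrite (_ : l = lshift r j); last exact: val_inj.
    by apply: polyfun_ext (pA k j) => X Y; rewrite row_mxEl.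
  rewrite (_ : l = rshift q j); last exact: val_inj.
  by apply: polyfun_ext (pB k j) => X Y; rewrite row_mxEr.
apply/polyfun_det/polymx_constraints.
  apply: (@polymx_row 6 3 5 4); last exact: polymx_cst.
  by move=> k l; apply: polyfun_ext (@polymx_fst _ _ k (lift i l)) => X Y; rewrite mxE.
apply: (@polymx_row 6 3 5 4); last apply: (@polymx_row 6 3 3 1); last exact: polymx_cst.
  by move=> k l; apply: polyfun_ext (@polymx_snd _ _ k (lift i l)) => X Y; rewrite mxE.
by move=> k l; apply: polyfun_ext (@polymx_snd _ _ k i) => X Y; rewrite mxE.
Qed.

Lemma generic_pin_cond : for_generic_tuples (fun X Y : 'M[R]_(3, 6) =>
  forall i, pin_cond i X Y != 0 /\ pin_cond i Y X != 0).
Proof.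
apply: generic_all => i.
(* With [y_i] the last coordinate point, the other five pairs kill all entries
   of the first two columns but [F o2 o1]. *)
pose at_ (s : seq nat) (d : nat) : 'M[R]_(3, 6) :=
  \matrix_(r, k) (val r == if unlift i k is Some j then nth 0%N s j else d)%:R.
apply: (@generic_polyfun_swap _ _ _ (at_ [:: 0; 0; 1; 1; 2]%N 0%N) (at_ [:: 0; 1; 0; 1; 0]%N 2%N)).
  exact: polyfun_pin_cond.
apply/pin_condP => F F5 Fy F21.
have colL (s : seq nat) d (k : 'I_5) (e : 'I_3) : nth 0%N s k = e ->
    col (lift i k) (at_ s d) = 1 *: delta_mx e 0.
  move=> se; apply/matrixP => r c; rewrite !mxE liftK se (ord1 c) mul1r andbT.
  by rewrite -val_eqE.
have F5' (k : 'I_5) (e f : 'I_3) : nth 0%N [:: 0; 0; 1; 1; 2]%N k = e ->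
    nth 0%N [:: 0; 1; 0; 1; 0]%N k = f -> F e f = 0.
  move=> ke kf; have := F5 k; rewrite (colL _ _ _ _ ke) (colL _ _ _ _ kf).
  by rewrite bil_delta !mul1r.
have F2 r : F r o2 = 0.
  have /matrixP/(_ r 0) := Fy; rewrite [RHS]mxE => <-.
  rewrite mxE sum3 !mxE unlift_none /= !mulr0 !add0r mulr1 //.
apply/matrixP => r c; rewrite mxE; elim/ord3_ind: c; elim/ord3_ind: r => //.
- exact: (F5' (@Ordinal 5 0 isT)).
- exact: (F5' (@Ordinal 5 2 isT)).
- exact: (F5' (@Ordinal 5 4 isT)).
- exact: (F5' (@Ordinal 5 1 isT)).
- exact: (F5' (@Ordinal 5 3 isT)).
Qed.

(** The net is carried along by [F |-> N^-T F M^-1]. *)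
Lemma net_cubic_subst n (X Y : 'M[R]_(3, n)) N M f :
  N \in unitmx -> M \in unitmx -> plane_form 3 f ->
  net_cubic (N *m X) (M *m Y) f ->
  exists2 h, plane_form 3 h & net_cubic X Y h.
Proof.
move=> uN uM pf netf; have [h ph hE] := plane_form_subst uN pf.
pose phi F := invmx N^T *m F *m invmx M; pose psi F := N^T *m F *m M.
have uNT : N^T \in unitmx by rewrite unitmx_tr.
have phiK F : phi (psi F) = F by rewrite /phi /psi !mulmxA mulVmx // mul1mx mulmxK.
have psiK F : psi (phi F) = F by rewrite /phi /psi !mulmxA mulmxV // mul1mx mulmxKV.
have bil_phi F x y : bil (phi F) (N *m x) (M *m y) = bil F x y.
  by rewrite /bil trmx_mul /phi !mulmxA mulmxK // -!mulmxA (mulmxA _ M y) mulVmx // mul1mx.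
have netE a F : left_net (N *m X) (M *m Y) (N *m a) (phi F) <-> left_net X Y a F.
  rewrite /left_net /epipolar.
  have -> : (forall i, bil (phi F) (col i (N *m X)) (col i (M *m Y)) = 0) <->
            (forall i, bil F (col i X) (col i Y) = 0).
    by split=> ep i; have := ep i; rewrite !colE -!mulmxA bil_phi.
  have -> : (phi F)^T *m (N *m a) = (invmx M)^T *m (F^T *m a).
    by rewrite /phi !trmx_mul (trmx_inv N^T) trmxK -!mulmxA mulKmx.
  split=> -[ep Fa]; split=> //; last by rewrite Fa mulmx0.
  have uMT : (invmx M)^T \in unitmx by rewrite unitmx_tr unitmx_inv.
  by move/(congr1 (mulmx (invmx (invmx M)^T))): Fa; rewrite mulKmx // mulmx0.
exists h => // a a0 ax.
have a0' := mulmx_neq0 uN a0.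
have [i|netf1 netf2] := netf _ a0'.
  by rewrite colE -mulmxA -colE => /(proj_eq_unit _ _ uN); exact: ax.
split; last first.
  move=> F G /netE nF /netE nG F0; have [|c cE] := netf2 _ _ nF nG.
    by apply: contra_neq F0 => F0; rewrite -[F]psiK F0 /psi mulmx0 mul0mx.
  by exists c; rewrite -[G]psiK cE /psi -scalemxAr -scalemxAl -/(psi _) psiK.
have -> : h.@[fun k => a k 0] = 0 <-> f.@[fun k => (N *m a) k 0] = 0.
  have := hE a; rewrite /on_curve => -[h1 h2]; split=> h0.
    by case: h1.
  by case: h2.
rewrite netf1; split=> -[F F0 nF].
  exists (psi F); last by apply/netE; rewrite phiK.
  by apply: contra_neq F0 => F0; rewrite -[F]phiK F0 /phi mulmx0 mul0mx.
exists (phi F); last exact/netE.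
by apply: contra_neq F0 => F0; rewrite -[F]psiK F0 /psi mulmx0 mul0mx.
Qed.

(** A point [a] of the cubic gives a form [F], singular but never of rank 1, and
    [b] is its right kernel.  The pair is excluded only when [a] is some [x_i]
    or [b] is some [y_i]; the latter determines [F], hence [a]. *)
Lemma six_points (X Y : 'M[R]_(3, 6)) f :
  point_tuple X -> point_tuple Y -> plane_form 3 f -> net_cubic X Y f ->
  no_three_collinear X -> no_three_collinear Y -> (forall i, pin_cond i X Y != 0) ->
  (forall a b, center_locus X Y a b -> on_curve f a) /\
  for_generic_point_on f (fun a => unique_point (center_locus X Y a)).
Proof.
move=> pX pY pf net cX cY pin.
have rank2 a F : a != 0 -> left_net X Y a F -> F != 0 -> \rank F = 2%N.
  move=> a0 [ep Fa] F0; apply: det0_rank2 => //; last exact: six_net_not_rank1 ep.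
  by apply: (row_det0 a0); rewrite -[F]trmxK -trmx_mul Fa trmx0.
have F_neq0 F : \rank F = 2%N -> F != 0 by rewrite -mxrank_eq0 => ->.
split.
  move=> a b /center_locusP-/(_ pX pY)[a0 _ xa _ [F [rF Fa _ ep]]].
  by split=> //; apply/(net _ a0 xa).1; exists F; [exact: F_neq0 | split].
split.
  by move=> s; case: pf => _ hf; exact: odd_curve_infinite hf.
pose bad i a := a != 0 /\ exists2 F, F != 0 & left_net X Y a F /\ F *m col i Y = 0.
have [s1 s1P] : exists s, forall a, avoids s a -> forall i, ~ bad i a.
  apply: finite_forall => i; apply: finite_of_unique => a a'.
  move=> [a0 [F F0 [nF Fy]]] [a'0 [G G0 [nG Gy]]].
  have /pin_condP pinF := pin i.
  have F21 : F o2 o1 != 0.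
    apply: contra_neq F0 => F21; apply: pinF => // k; exact: nF.1.
  have GE : G = (G o2 o1 / F o2 o1) *: F.
    apply/eqP; rewrite -subr_eq0; apply/eqP; apply: pinF => [k||].
    - by rewrite bilB nF.1 nG.1 mulr0 subr0.
    - by rewrite mulmxBl -scalemxAl Fy Gy scaler0 subr0.
    - by rewrite !mxE divfK // subrr.
  have c0 : G o2 o1 / F o2 o1 != 0.
    by apply: contra_neq G0 => c0; rewrite GE c0 scale0r.
  have FT : \rank F^T = 2%N by rewrite mxrank_tr (rank2 a).
  apply: (ker_proj_eq FT) => //; first exact: nF.2.
  by have := nG.2; rewrite GE linearZ -scalemxAl => /eqP;
    rewrite scaler_eq0 (negbTE c0) => /eqP.
exists (s1 ++ [seq col i X | i <- enum 'I_6]) => a [a0 fa] av.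
have xa i : ~ proj_eq (col i X) a.
  move/proj_eq_sym; apply: av; rewrite mem_cat; apply/orP; right.
  by apply: map_f; exact: mem_enum.
have nbad : forall i, ~ bad i a.
  by apply: s1P => c cs; apply: av; rewrite mem_cat cs.
have [[/(_ fa)[F F0 nF] _] uF] := net _ a0 xa.
have rF := rank2 _ _ a0 nF F0.
have [b b0 Fb] : exists2 b : 'cV[R]_3, b != 0 & F *m b = 0.
  apply: det0_col; apply: (row_det0 a0).
  by rewrite -[F]trmxK -trmx_mul nF.2 trmx0.
exists b.
  apply/center_locusP => //; split=> //.
    move=> i [c _ yE]; apply: (nbad i); split=> //; exists F => //; split=> //.
    by rewrite yE -scalemxAr Fb scaler0.
  by exists F; split=> //; [exact: nF.2 | exact: nF.1].
move=> b' /center_locusP-/(_ pX pY)[_ b'0 _ _ [G [rG Ga Gb ep]]].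
have [c GE] := uF F G nF (conj ep Ga) F0.
apply: (ker_proj_eq rF) => //; have G0 := F_neq0 _ rG.
move: Gb; rewrite GE -scalemxAl => /eqP; rewrite scaler_eq0 => /orP[/eqP c0|/eqP //].
by rewrite GE c0 scale0r eqxx in G0.
Qed.
End SixPoints.

(** * Seven points and more *)

Section ManyPoints.
Variable R : realType.
Implicit Types (a b g x y u v w : 'cV[R]_3) (F G N M : 'M[R]_3).
Implicit Types (P Q : 'M[R]_(3, 3 * 3)).

Let k7 : 'I_(3 * 3) := @Ordinal 9 7 isT.
Let k8 : 'I_(3 * 3) := @Ordinal 9 8 isT.

(** By Cramer's rule, the last row of the adjugate of the constraint matrix
    spans the solutions of the first eight constraints. *)
Definition eight_form P Q : 'M[R]_3 := vec_mx (row k8 (\adj (constraints P Q))).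

Lemma bil_eight_form P Q k :
  bil (eight_form P Q) (col k P) (col k Q) = \det (constraints P Q) *+ (k == k8).
Proof.
rewrite -mul_constraints vec_mxK -row_mul mul_adj_mx !mxE.
by rewrite eq_sym.
Qed.

Lemma eight_form_unique P Q F : \det (constraints P Q) != 0 ->
  (forall k : 'I_(3 * 3), (k < 8)%N -> bil F (col k P) (col k Q) = 0) ->
  exists c, F = c *: eight_form P Q.
Proof.
move=> d F8; exists (bil F (col k8 P) (col k8 Q) / \det (constraints P Q)).
apply/eqP; rewrite -subr_eq0; apply/eqP; move/det_constraints: (d); apply => k.
rewrite bilB bil_eight_form; have [->|kk8] := eqVneq k k8.
  by rewrite mulr1n divfK // subrr.
rewrite mulr0n mulr0 subr0 F8 // ltn_neqAle -ltnS (ltn_ord k) andbT.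
by apply: contra_neq kk8 => h; apply: val_inj.
Qed.

Definition eight_cond P Q := \det (constraints P Q) * \det (eight_form P Q).

Lemma polyfun_eight_cond : @polyfun R (3 * 3) eight_cond.
Proof.
have pC : polymx (fun P Q => constraints P Q).
  by apply: polymx_constraints; [exact: polymx_fst | exact: polymx_snd].
apply: polyfunM; first exact: polyfun_det.
apply: polyfun_det => i j.
by apply: polyfun_ext (polymx_adj pC k8 (mxvec_index i j)) => X Y; rewrite !mxE.
Qed.

(** The first eight pairs of points are conjugate for the identity form, and for
    no other form up to scale; the ninth excludes the identity. *)
Definition base_left : 'M[R]_(3, 3 * 3) := \matrix_(i, k)
  (nth (0 : 'cV_3) [:: vec3 1 0 0; vec3 1 0 0; vec3 0 1 0; vec3 0 1 0; vec3 0 0 1;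
                 vec3 0 0 1; vec3 1 1 0; vec3 0 1 1; vec3 1 0 0] k) i 0.
Definition base_right : 'M[R]_(3, 3 * 3) := \matrix_(i, k)
  (nth (0 : 'cV_3) [:: vec3 0 1 0; vec3 0 0 1; vec3 1 0 0; vec3 0 0 1; vec3 1 0 0;
                 vec3 0 1 0; vec3 1 (-1) 0; vec3 0 1 (-1); vec3 1 0 0] k) i 0.

Lemma base_scalar F :
  (forall k : 'I_(3 * 3), (k < 8)%N -> bil F (col k base_left) (col k base_right) = 0) ->
  F = (F o0 o0)%:M.
Proof.
move=> F8; have E (k : 'I_9) := F8 k.
have := E (@Ordinal 9 7 isT) isT; have := E (@Ordinal 9 6 isT) isT.
have := E (@Ordinal 9 5 isT) isT; have := E (@Ordinal 9 4 isT) isT.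
have := E (@Ordinal 9 3 isT) isT; have := E (@Ordinal 9 2 isT) isT.
have := E (@Ordinal 9 1 isT) isT; have := E (@Ordinal 9 0 isT) isT.
rewrite !bilE !sum3; do 3![rewrite ?mxE /=] => h1 h2 h3 h4 h5 h6 h7 h8.
apply/matrixP => i j; rewrite !mxE.
by elim/ord3_ind: i; elim/ord3_ind: j; rewrite /= ?mulr1n ?mulr0n; lra.
Qed.

Lemma eight_cond_base : eight_cond base_left base_right != 0.
Proof.
have d : \det (constraints base_left base_right) != 0.
  apply/det_constraints => F FC; have F8 := base_scalar (fun k _ => FC k).
  rewrite F8; suff -> : F o0 o0 = 0 by apply/matrixP => i j; rewrite !mxE mul0rn.
  have := FC (@Ordinal 9 8 isT); rewrite !bilE !sum3; do 3![rewrite ?mxE /=]; lra.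
rewrite /eight_cond mulf_neq0 //.
have bil8 := bil_eight_form base_left base_right.
have := @base_scalar (eight_form base_left base_right).
move: bil8; move: (eight_form base_left base_right) => F bil8 ->; last first.
  move=> k k8lt; rewrite bil8; case: eqP => // kE; move: k8lt.
  by rewrite kE.
rewrite det_scalar expf_neq0 //.
have := bil8 k8; rewrite eqxx mulr1n => dE; move: d; rewrite -dE.
apply: contra_neq => F0; rewrite bilE !sum3; do 3![rewrite ?mxE /=]; rewrite F0; ring.
Qed.

Lemma generic_eight_cond n : for_generic_tuples (fun X Y : 'M[R]_(3, n) =>
  eight_cond (pad base_left X) (pad base_right Y) != 0).
Proof.
apply: (@generic_polyfun _ _
   (fun X Y => eight_cond (pad base_left X) (pad base_right Y))
   (pad 0 base_left) (pad 0 base_right)).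
  apply: polyfun_comp polyfun_eight_cond _ _; apply: polymx_pad.
    exact: polymx_fst.
  exact: polymx_snd.
by rewrite !pad_pad eight_cond_base.
Qed.

Lemma epipolar_pad n (X Y : 'M[R]_(3, n)) P Q F (k : 'I_(3 * 3)) : (k < n)%N ->
  epipolar X Y F -> bil F (col k (pad P X)) (col k (pad Q Y)) = 0.
Proof.
move=> kn ep; rewrite (@col_pad _ _ _ P X k (Ordinal kn)) //.
by rewrite (@col_pad _ _ _ Q Y k (Ordinal kn)).
Qed.

Lemma det_rank2 F : \rank F = 2%N -> \det F = 0.
Proof.
move=> rF; apply/eqP; rewrite -[_ == 0]negbK -unitfE -unitmxE -row_free_unit.
by rewrite /row_free rF.
Qed.

(** Up to scale only one form satisfies eight constraints, and it is nonsingular,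
    whereas a pair of cameras would give a form of rank 2. *)
Lemma eight_points n (X Y : 'M[R]_(3, n)) : (7 < n)%N ->
  point_tuple X -> point_tuple Y ->
  eight_cond (pad base_left X) (pad base_right Y) != 0 ->
  ~ exists a b, center_locus X Y a b.
Proof.
move=> n8 pX pY; rewrite mulf_eq0 negb_or => /andP[d dF].
move=> [a [b /center_locusP-/(_ pX pY)[_ _ _ _ [F [rF _ _ ep]]]]].
have [|c FE] := @eight_form_unique _ _ F d.
  by move=> k k8lt; apply: epipolar_pad ep; exact: leq_trans k8lt n8.
have /eqP := det_rank2 rF; rewrite FE detZ mulf_eq0 (negbTE dF) orbF expf_eq0 => /eqP c0.
by move: rF; rewrite FE c0 scale0r mxrank0.
Qed.

Lemma det_pencil F G : exists s t, forall c,
  \det (F + c *: G) = \det F + c * (s + c * (t + c * \det G)).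
Proof.
pose mix i F G : 'M[R]_3 := \matrix_(k, j) if k == i then G k j else F k j.
exists (\sum_i \det (mix i F G)), (\sum_i \det (mix i G F)) => c.
rewrite !sum3 !det3 !mxE /=; ring.
Qed.

(** Counting by an invariant: there are no more classes than values [c] of the
    invariant, and these are roots of [p]. *)
Lemma cover_by_roots (T : eqType) (P : T -> Prop) (E : T -> T -> Prop)
    (K : T -> R -> Prop) (p : {poly R}) : p != 0 ->
  (forall t, P t -> exists2 c, K t c & root p c) ->
  (forall t t' c, P t -> P t' -> K t c -> K t' c -> E t t') ->
  exists s : seq T, (size s < size p)%N /\ forall t, P t -> exists2 u, u \in s & E t u.
Proof.
move=> p0 Kp KE.
have [rs rs_p p_rs] : exists2 rs : seq R, (size rs < size p)%N & forall c, root p c -> c \in rs.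
  exists (rootsR p) => [|c rc].
    apply: (max_poly_roots p0); last exact: uniq_roots.
    by apply/allP => c; rewrite -(roots_on_rootsR p0) => /andP[].
  by rewrite -(roots_on_rootsR p0) rc.
have [s [ss sP]] : exists s : seq T, (size s <= size rs)%N /\
    forall t, P t -> (exists2 c, c \in rs & K t c) -> exists2 u, u \in s & E t u.
  elim: rs {rs_p p_rs} => [|c rs [s [ss sP]]]; first by exists [::]; split=> // t _ [].
  have [[z [Pz Kz]]|none] := boolp.pselect (exists z, P z /\ K z c).
    exists (z :: s); split=> // t Pt [e]; rewrite inE => /orP[/eqP-> Kt|ers Kt].
      by exists z; [exact: mem_head | exact: KE Kt Kz].
    have [|z' z's Ez'] := sP t Pt; first by exists e.
    by exists z' => //; rewrite inE z's orbT.
  exists s; split; first exact: leq_trans ss (leqnSn _).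
  move=> t Pt [e]; rewrite inE => /orP[/eqP-> Kt|ers Kt]; last by apply: sP => //; exists e.
  by case: none; exists t.
exists s; split; first exact: leq_ltn_trans ss rs_p.
move=> t Pt; apply: sP => //; have [c Kc /p_rs] := Kp t Pt; by exists c.
Qed.

(** Scaled to the value 1 at an auxiliary eighth pair, the forms satisfying the
    seven constraints make up a line [F1 + c B], where [B] satisfies all eight.
    The determinant on this line is a cubic in [c] with leading coefficient
    [\det B], which is generically nonzero, and a form of rank 2 determines its
    two kernels. *)
Lemma seven_points (X Y : 'M[R]_(3, 7)) :
  point_tuple X -> point_tuple Y ->
  eight_cond (pad base_left X) (pad base_right Y) != 0 ->
  exists s : seq ('cV[R]_3 * 'cV[R]_3), (size s <= 3)%N /\
    forall a b, center_locus X Y a b ->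
      exists2 c, c \in s & proj_eq a c.1 /\ proj_eq b c.2.
Proof.
set P := pad _ X; set Q := pad _ Y; move=> pX pY.
rewrite mulf_eq0 negb_or => /andP[d dB]; set B := eight_form P Q in dB.
pose norm_form a b F := [/\ \rank F = 2%N, F^T *m a = 0, F *m b = 0, epipolar X Y F
  & bil F (col k7 P) (col k7 Q) = 1].
have unique F : epipolar X Y F -> bil F (col k7 P) (col k7 Q) = 0 -> exists c, F = c *: B.
  move=> ep F7; apply: eight_form_unique => // k k8lt.
  have [k7lt|k7le] := ltnP k 7; first exact: epipolar_pad.
  rewrite (_ : k = k7) //; apply/val_inj/anti_leq; rewrite k7le andbT.
  by rewrite -ltnS.
have normP a b : center_locus X Y a b -> exists F, norm_form a b F.
  move=> /center_locusP-/(_ pX pY)[_ _ _ _ [F [rF Fa Fb ep]]].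
  have l0 : bil F (col k7 P) (col k7 Q) != 0.
    apply/eqP => /(unique _ ep)[c FE]; have /eqP := det_rank2 rF.
    rewrite FE detZ mulf_eq0 (negbTE dB) orbF expf_eq0 => /eqP c0.
    by move: rF; rewrite FE c0 scale0r mxrank0.
  exists ((bil F (col k7 P) (col k7 Q))^-1 *: F).
  have bilZ c x y : bil (c *: F) x y = c * bil F x y.
    by rewrite /bil -scalemxAr -scalemxAl mxE.
  split.
  - by rewrite mxrank_scale_nz // invr_eq0.
  - by rewrite linearZ -scalemxAl Fa scaler0.
  - by rewrite -scalemxAl Fb scaler0.
  - by move=> i; rewrite bilZ ep mulr0.
  - by rewrite bilZ mulVf.
have [[a1 [b1 /normP[F1 nF1]]]|none] :=
    boolp.pselect (exists a b, center_locus X Y a b); last first.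
  by exists [::]; split=> // a b Lab; case: none; exists a, b.
have [s [t dE]] := det_pencil F1 B.
pose p : {poly R} := Poly [:: 0; s; t; \det B].
have pE c : p.[c] = \det (F1 + c *: B).
  have [r1 _ _ _ _] := nF1; rewrite dE (det_rank2 r1) horner_Poly /=; ring.
have p0 : p != 0.
  by apply: contra_neq dB => /(congr1 (fun p : {poly R} => p`_3)); rewrite coef_Poly coef0.
pose K (t : 'cV[R]_3 * 'cV[R]_3) c := norm_form t.1 t.2 (F1 + c *: B).
have [||z [sz zP]] := @cover_by_roots _
    (fun t : 'cV[R]_3 * 'cV[R]_3 => center_locus X Y t.1 t.2)
    (fun t t' => proj_eq t.1 t'.1 /\ proj_eq t.2 t'.2) K p p0.
- move=> [a b] /= /normP[F nF].
  have [_ _ _ ep1 l1] := nF1; have [rF _ _ ep l] := nF.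
  have [||c cE] := unique (F - 1 *: F1).
  + by move=> i; rewrite bilB ep ep1 mulr0 subr0.
  + by rewrite bilB l l1 mulr1 subrr.
  have FE : F = F1 + c *: B by rewrite -cE scale1r addrC subrK.
  exists c; first by rewrite /K -FE.
  by apply/eqP; rewrite pE -FE det_rank2.
- move=> [a b] [a' b'] c /= La La' [rF Fa Fb _ _] [_ Fa' Fb' _ _].
  have [a0 b0] : a != 0 /\ b != 0 by case: La => A [C [_ _ [? _] [? _] _]].
  have [a0' b0'] : a' != 0 /\ b' != 0 by case: La' => A [C [_ _ [? _] [? _] _]].
  split; last exact: (ker_proj_eq rF).
  by apply: (ker_proj_eq _ Fa Fa'); rewrite ?mxrank_tr.
exists z; split; last by move=> a b /(zP (a, b)).
by have := leq_trans sz (size_Poly _).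
Qed.
End ManyPoints.

(** * Witnesses of genericity and the theorem *)

Section Assembly.
Variable R : realType.
Implicit Types (a b x y : 'cV[R]_3).

Definition witness n (s : seq 'cV[R]_3) : 'M[R]_(3, n) :=
  \matrix_(r, i) (nth 0 [:: vec3 1 0 0, vec3 0 1 0, vec3 0 0 1 & s] i) r 0.

Lemma frame_witness n s : frame (witness n s) = 1%:M.
Proof.
apply/matrixP => r k; rewrite mxE; case: insubP => // i _ ik; rewrite mxE ik [RHS]mxE.
by elim/ord3_ind: k r {i ik}; elim/ord3_ind; rewrite mxE.
Qed.

Lemma col_witness n s (i : 'I_n) :
  col i (witness n s) = nth 0 [:: vec3 1 0 0, vec3 0 1 0, vec3 0 0 1 & s] i.
Proof. by apply/matrixP => r c; rewrite !mxE (ord1 c). Qed.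

Lemma cross_vec3 (r1 r2 r3 s1 s2 s3 : R) : cross (vec3 r1 r2 r3) (vec3 s1 s2 s3) =
  vec3 (r2 * s3 - r3 * s2) (r3 * s1 - r1 * s3) (r1 * s2 - r2 * s1).
Proof. by rewrite /cross !mxE. Qed.

Lemma hadamard_vec3 (r1 r2 r3 s1 s2 s3 : R) :
  hadamard (vec3 r1 r2 r3) (vec3 s1 s2 s3) = vec3 (r1 * s1) (r2 * s2) (r3 * s3).
Proof. by apply: col3P; rewrite !mxE. Qed.

Lemma center_locus_swap n (X Y : 'M[R]_(3, n)) b :
  (fun a => center_locus X Y a b) = center_locus Y X b.
Proof.
by apply: boolp.funext => a; apply: boolp.propext; split=> /center_locusC.
Qed.

Lemma generic_both n (H : 'M[R]_(3, n) -> 'M[R]_(3, n) -> Prop)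
    (C : 'M[R]_(3, n) -> 'M[R]_(3, n) -> R) X0 Y0 :
  frame X0 = 1%:M -> frame Y0 = 1%:M -> polyfun C -> C X0 Y0 != 0 ->
  (forall X Y, point_tuple X -> point_tuple Y ->
     \det (frame X) != 0 -> \det (frame Y) != 0 ->
     C (normalize X) (normalize Y) != 0 -> H X Y) ->
  for_generic_tuples (fun X Y => H X Y /\ H Y X).
Proof.
move=> fX fY pC C0 CH.
have := generic_and (generic_frame R n) (generic_normalize fX fY pC C0).
by apply: generic_mono => X Y pX pY [[dX dY] [cXY cYX]]; split; apply: CH.
Qed.

Lemma generic_four : for_generic_tuples (fun X Y : 'M[R]_(3, 4) =>
  for_generic_point (fun a => fills_conic (center_locus X Y a)) /\
  for_generic_point (fun b => fills_conic (center_locus Y X b))).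
Proof.
pose j3 := @Ordinal 4 3 isT.
apply: (@generic_both _ (fun X Y => for_generic_point (fun a => fills_conic (center_locus X Y a)))
  (fun X Y => (\prod_k col j3 X k 0) * \prod_k col j3 Y k 0)
  (witness 4 [:: const_mx 1]) (witness 4 [:: const_mx 1])); try exact: frame_witness.
- apply: polyfunM; apply: polyfun_prod3; apply: polymx_col;
    by [exact: polymx_fst | exact: polymx_snd].
- by rewrite !prod3; do 3![rewrite ?mxE /=]; rewrite !mulr1 oner_neq0.
move=> X Y pX pY dX dY; rewrite mulf_eq0 negb_or => /andP[/prod_neq0 xk /prod_neq0 yk].
rewrite locus_normalize //.
have uX := to_frame_unit dX; have uY := to_frame_unit dY.
apply: (generic_point_subst uX (P := fun a => fills_conic
  (fun b => center_locus (normalize X) (normalize Y) a (to_frame Y *m b)))).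
apply: (@generic_point_mono _ (fun a => fills_conic
  (center_locus (normalize X) (normalize Y) a))).
  by move=> a _ /(fills_conic_subst uY).
apply: four_points; try exact: normalize_normalized; try exact: point_tuple_normalize.
- by move=> k; have := xk k; rewrite mxE.
- by move=> k; have := yk k; rewrite mxE.
Qed.

Lemma generic_five : for_generic_tuples (fun X Y : 'M[R]_(3, 5) =>
  for_generic_point (fun a => unique_point (center_locus X Y a)) /\
  for_generic_point (fun b => unique_point (center_locus Y X b))).
Proof.
apply: (@generic_both _ (fun X Y => for_generic_point (fun a => unique_point (center_locus X Y a)))
  (five_cond (vec3 1 1 1))
  (witness 5 [:: vec3 1 2 4; vec3 1 3 2]) (witness 5 [:: vec3 1 1 1; vec3 1 2 3]));
  try exact: frame_witness.
- exact: polyfun_five_cond.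
(* Here [five_g] is [(-16, -13, -7)]. *)
- rewrite /five_cond /five_miss /five_g /residual !prod3 !col_witness /=.
  rewrite !(cross_vec3, hadamard_vec3) ![vec3 _ _ _ _ _]mxE /=.
  by rewrite !mulf_neq0 //; (apply: lt0r_neq0; lra) || (apply: ltr0_neq0; lra).
move=> X Y pX pY dX dY cXY; rewrite locus_normalize //.
have uX := to_frame_unit dX; have uY := to_frame_unit dY.
apply: (generic_point_subst uX (P := fun a => unique_point
  (fun b => center_locus (normalize X) (normalize Y) a (to_frame Y *m b)))).
apply: (@generic_point_mono _ (fun a => unique_point
  (center_locus (normalize X) (normalize Y) a))).
  by move=> a _ /(unique_point_subst uY).
by apply: five_points cXY; try exact: normalize_normalized; try exact: point_tuple_normalize.
Qed.

Lemma generic_six_cubic : for_generic_tuples (fun X Y : 'M[R]_(3, 6) =>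
  (exists2 f, plane_form 3 f & net_cubic X Y f) /\
  (exists2 g, plane_form 3 g & net_cubic Y X g)).
Proof.
apply: (@generic_both _ (fun X Y => exists2 f, plane_form 3 f & net_cubic X Y f)
  (six_cond (vec3 1 1 1))
  (witness 6 [:: vec3 1 2 4; vec3 1 3 2; vec3 2 1 1])
  (witness 6 [:: vec3 1 1 1; vec3 1 2 3; vec3 1 1 2]));
  try exact: frame_witness.
- exact: polyfun_six_cond.
(* The two determinants are 1 and -75. *)
- have entry i k (s : seq 'cV[R]_3) : witness 6 s k i = col i (witness 6 s) k 0.
    by rewrite [RHS]mxE.
  rewrite /six_cond !det3 /six_mx /weight /residual !prod3 !entry !col_witness /=.
  rewrite ![vec3 _ _ _ _ _]mxE /= !(cross_vec3, hadamard_vec3) ![mx3 _ _ _ _ _]mxE.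
  rewrite ![vec3 _ _ _ _ _]mxE /=.
  by rewrite !mulf_neq0 //; (apply: lt0r_neq0; lra) || (apply: ltr0_neq0; lra).
move=> X Y pX pY dX dY cXY.
have uX := to_frame_unit dX; have uY := to_frame_unit dY.
have [||| f pf netf] := six_points_cubic _ _ _ cXY;
  try exact: normalize_normalized; try exact: point_tuple_normalize.
exact: net_cubic_subst uX uY pf netf.
Qed.

Lemma generic_six : for_generic_tuples (fun X Y : 'M[R]_(3, 6) =>
  exists f g : {mpoly R[3]},
    [/\ plane_form 3 f, plane_form 3 g,
        forall a b, center_locus X Y a b -> on_curve f a /\ on_curve g b,
        for_generic_point_on f (fun a => unique_point (center_locus X Y a))
      & for_generic_point_on g (fun b => unique_point (center_locus Y X b))]).
Proof.
have := generic_and generic_six_cubic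
  (generic_and (generic_no_three_collinear R 6) (generic_pin_cond R)).
apply: generic_mono => X Y pX pY [[[f pf netf] [g pg netg]] [[cX cY] pin]].
exists f, g.
have [Lf uf] := six_points pX pY pf netf cX cY (fun i => (pin i).1).
have [Lg ug] := six_points pY pX pg netg cY cX (fun i => (pin i).2).
by split=> // a b Lab; split; [exact: Lf Lab | exact: Lg (center_locusC Lab)].
Qed.
End Assembly.

Theorem theorem1 (R : realType) (n : nat) :
  for_generic_tuples (fun X Y : 'M[R]_(3, n) =>
    let L := center_locus X Y in
    [/\ (n < 4)%N ->
          exists (d e : nat) (f g : {mpoly R[3]}),
            [/\ plane_form d f, plane_form e g
              & forall a b : 'cV[R]_3, a != 0 -> b != 0 ->
                  ~ on_curve f a -> ~ on_curve g b -> L a b],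
        n = 4%N ->
          for_generic_point (fun a => fills_conic (fun b => L a b)) /\
          for_generic_point (fun b => fills_conic (fun a => L a b)),
        n = 5%N ->
          for_generic_point (fun a => unique_point (fun b => L a b)) /\
          for_generic_point (fun b => unique_point (fun a => L a b)),
        n = 6%N ->
          exists f g : {mpoly R[3]},
            [/\ plane_form 3 f, plane_form 3 g,
                forall a b, L a b -> on_curve f a /\ on_curve g b,
                for_generic_point_on f (fun a => unique_point (fun b => L a b))
              & for_generic_point_on g (fun b => unique_point (fun a => L a b))]
      & (n = 7%N ->
          exists s : seq ('cV[R]_3 * 'cV[R]_3),
            (size s <= 3)%N /\
            forall a b, L a b ->
              exists2 c, c \in s & proj_eq a c.1 /\ proj_eq b c.2) /\
        ((7 < n)%N -> ~ exists a b, L a b)]).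
Proof.
have swap m (X Y : 'M[R]_(3, m)) (P : ('cV[R]_3 -> Prop) -> Prop) :
    for_generic_point (fun b => P (center_locus Y X b)) ->
    for_generic_point (fun b => P (fun a => center_locus X Y a b)).
  by apply: generic_point_mono => b _; rewrite center_locus_swap.
have [n8|n8] := ltnP 7 n.
  apply: generic_mono (generic_eight_cond R n) => X Y pX pY cXY L.
  split=> [/(ltn_trans n8)//|h|h|h|]; try by rewrite h in n8.
  by split=> [h|_]; [rewrite h in n8 | exact: eight_points cXY].
have [n4|] := ltnP n 4.
  apply: generic_mono (generic_frame R n) => X Y pX pY [dX dY] L.
  split=> [_|h|h|h|]; [exact: locus_le3|by rewrite h in n4..|].
  by split=> // h; rewrite h in n4.
case: n n8 => [|[|[|[|[|[|[|[|n]]]]]]]] // _ _.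
- apply: generic_mono (generic_four R) => X Y pX pY [hX hY] L.
  by split=> // _; split=> //; exact: swap.
- apply: generic_mono (generic_five R) => X Y pX pY [hX hY] L.
  by split=> // _; split=> //; exact: swap.
- apply: generic_mono (generic_six R) => X Y pX pY h L; split=> // _.
  have [f [g [pf pg Lfg uf ug]]] := h; exists f, g; split=> //.
  have [inf [s sP]] := ug; split=> //; exists s => b gb sb.
  by rewrite center_locus_swap; exact: sP.
- apply: generic_mono (generic_eight_cond R 7) => X Y pX pY cXY L.
  by split=> //; split=> // _; exact: seven_points cXY.
Qed.
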